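(* Let $\mathscr C$ be a hereditary class of graphs. Assume that (i) for every positive integer $p$ there exist a hereditary NIP class $\mathscr D_p$ and a non-decreasing function $f_p$ with $f_p(n)=n^{o(1)}$ such that the vertex set of every $G\in\mathscr C$ can be partitioned into at most $f_p(|G|)$ parts with the union of any $p$ parts inducing a subgraph in $\mathscr D_p$; and (ii) there exist a hereditary stable class $\mathscr S$ and a non-decreasing function $g$ with $g(n)=n^{o(1)}$ such that the vertex set of every $G\in\mathscr C$ can be partitioned into at most $g(|G|)$ parts with the union of any $2$ parts inducing a subgraph in $\mathscr S$. Then $\mathscr C$ is stable. In particular, the set $\Pi_{\mathrm{stable}}$ of all hereditary stable classes is a decomposition horizon, i.e. $\Pi_{\mathrm{stable}}^\ast=\Pi_{\mathrm{stable}}$.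
   Context: Graphs are finite and simple; formulas are first-order formulas in the language of graphs (adjacency relation $E$ and equality). A class $\mathscr C$ is unstable if there is a formula $\varphi(\bar x,\bar y)$ such that for every $n$ there exist $G\in\mathscr C$ and tuples $\bar u_1,\dots,\bar u_n\in V(G)^{|\bar x|}$, $\bar v_1,\dots,\bar v_n\in V(G)^{|\bar y|}$ with $G\models\varphi(\bar u_i,\bar v_j)\iff i\le j$; otherwise it is stable. A class is independent if there is a formula $\varphi(\bar x,\bar y)$ such that for every $n$ there exist $G\in\mathscr C$, tuples $\bar u_1,\dots,\bar u_n$ and $\bar v_J$ ($J\subseteq[n]$) with $G\models\varphi(\bar u_i,\bar v_J)\iff i\in J$; otherwise it is NIP. A hereditary class is a class of graphs closed under isomorphism and induced subgraphs. A hereditary class property is a set $\Pi$ of hereditary classes closed under passing to hereditary subclasses. For non-decreasing $f$ and positive integer $p$, $\mathscr C$ has an $f$-bounded $\Pi$-decomposition with parameter $p$ if there is $\mathscr D_p\in\Pi$ such that every $G\in\mathscr C$ has a partition $V_1,\dots,V_N$ of $V(G)$, $N\le f(|G|)$, with $G[V_{i_1}\cup\dots\cup V_{i_p}]\in\mathscr D_p$ for all $i_1,\dots,i_p\in[N]$. $\Pi^\ast$ is the set of hereditary classes having, for every positive integer $p$, an $f$-bounded $\Pi$-decomposition with parameter $p$ for some non-decreasing $f$ with $f(n)=n^{o(1)}$; $\Pi$ is a decomposition horizon if $\Pi^\ast=\Pi$. *)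

(* Defs.v *)
From mathcomp Require Import all_boot.
Set Implicit Arguments. Unset Strict Implicit. Unset Printing Implicit Defensive.

Record graph := Graph {
  gV : finType;
  gE : rel gV;
  gE_sym : symmetric gE;
  gE_irr : irreflexive gE }.

Definition gsize (G : graph) : nat := #|gV G|.

Section Induced.
Variables (G : graph) (S : {set gV G}).
Definition ind_V : finType := {x : gV G | x \in S}.
Definition ind_E : rel ind_V := fun x y => gE (val x) (val y).
Lemma ind_E_sym : symmetric ind_E.
Proof. by move=> x y; rewrite /ind_E gE_sym. Qed.
Lemma ind_E_irr : irreflexive ind_E.
Proof. by move=> x; rewrite /ind_E gE_irr. Qed.
Definition induced : graph := Graph ind_E_sym ind_E_irr.
End Induced.

Definition isomorphic (G H : graph) : Prop :=
  exists f : gV G -> gV H, bijective f /\ forall x y, gE (f x) (f y) = gE x y.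

Definition gclass := graph -> Prop.

Definition hereditary (C : gclass) : Prop :=
  (forall G H, C G -> isomorphic G H -> C H) /\
  (forall G (S : {set gV G}), C G -> C (induced S)).

(* ---------- First-order formulas in the language {E, =} ----------
   formula n : formulas whose free variables are among the n variables 'I_n
   (well-scoped de Bruijn; FEx binds variable 0 and shifts the others). *)
Inductive formula : nat -> Type :=
| FEdge n : 'I_n -> 'I_n -> formula n
| FEq n : 'I_n -> 'I_n -> formula n
| FNot n : formula n -> formula n
| FAnd n : formula n -> formula n -> formula n
| FEx n : formula n.+1 -> formula n.

Definition ext_env (V : Type) n (x : V) (e : 'I_n -> V) : 'I_n.+1 -> V :=
  fun i => match unlift ord0 i with Some j => e j | None => x end.

Fixpoint sat (G : graph) n (phi : formula n) : ('I_n -> gV G) -> Prop :=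
  match phi in formula m return ('I_m -> gV G) -> Prop with
  | FEdge _ i j => fun e => gE (e i) (e j)
  | FEq _ i j => fun e => e i = e j
  | FNot _ f => fun e => ~ sat f e
  | FAnd _ f g => fun e => sat f e /\ sat g e
  | FEx _ f => fun e => exists x : gV G, sat f (ext_env x e)
  end.

Definition join_env (V : Type) k l (u : 'I_k -> V) (v : 'I_l -> V) : 'I_(k + l) -> V :=
  fun i => match split i with inl a => u a | inr b => v b end.

Definition unstable (C : gclass) : Prop :=
  exists k l (phi : formula (k + l)), forall n : nat,
    exists G : graph, C G /\
      exists (u : 'I_n -> 'I_k -> gV G) (v : 'I_n -> 'I_l -> gV G),
        forall i j : 'I_n, sat phi (join_env (u i) (v j)) <-> (i <= j)%N.

Definition stable (C : gclass) : Prop := ~ unstable C.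

Definition independent (C : gclass) : Prop :=
  exists k l (phi : formula (k + l)), forall n : nat,
    exists G : graph, C G /\
      exists (u : 'I_n -> 'I_k -> gV G) (v : {set 'I_n} -> 'I_l -> gV G),
        forall (i : 'I_n) (J : {set 'I_n}), sat phi (join_env (u i) (v J)) <-> i \in J.

Definition NIP (C : gclass) : Prop := ~ independent C.

Definition nondecreasing (f : nat -> nat) : Prop := forall m n, m <= n -> f m <= f n.

(* f(n) = n^{o(1)}: for every eps = 1/a > 0, eventually f(n) <= n^(1/a), i.e. f(n)^a <= n. *)
Definition subpoly (f : nat -> nat) : Prop :=
  forall a : nat, 0 < a -> exists N : nat, forall n, N <= n -> f n ^ a <= n.

(* ---------- Decompositions ----------
   C has an f-bounded decomposition into D with parameter p: every G in C has a
   partition V_1..V_N (given by part : V(G) -> 'I_N, parts possibly empty), N <= f |G|,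
   such that G[V_{i_1} u ... u V_{i_p}] is in D for all i_1..i_p in [N]. *)
Definition has_decomp (C D : gclass) (f : nat -> nat) (p : nat) : Prop :=
  forall G, C G -> exists N, N <= f (gsize G) /\
    exists part : gV G -> 'I_N,
      forall s : 'I_p -> 'I_N, D (induced [set x | part x \in [seq s i | i : 'I_p]]).

Definition class_property := gclass -> Prop.

Definition Pi_star (Pi : class_property) : class_property := fun C =>
  hereditary C /\
  forall p : nat, 0 < p -> exists (f : nat -> nat) (D : gclass),
      Pi D /\ nondecreasing f /\ subpoly f /\ has_decomp C D f p.

Definition decomposition_horizon (Pi : class_property) : Prop :=
  forall C, Pi_star Pi C <-> Pi C.

Definition Pi_stable : class_property := fun C => hereditary C /\ stable C.

(* Main.v *)
Require Import Defs.
From mathcomp Require Import all_boot.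
From mathcomp Require Import boolp zify.
Set Implicit Arguments. Unset Strict Implicit. Unset Printing Implicit Defensive.

(** Suppose a formula of quantifier rank [q] orders arbitrarily long sequences of tuples
    in graphs of C.  Pigeonhole on colours gives two consequences of the hypotheses: by (ii),
    C omits a half graph; by (i), C omits every "grid configuration" of some order, in which
    a fixed formula, evaluated in an induced subgraph, holds between the [i]-th row and the
    [j]-th column exactly when a bounded set of witnesses attached to [(i, j)] is present.
    (A configuration of order [n] has polynomial size in [n], so a subpolynomial colouring
    leaves a large sub-grid using boundedly many colours, and that one is independent.)

    After Ramsey the tuples form a sunflower.  Starting from the petals one grows, [2^q]
    times, pairwise disjoint sets "balls" such that adjacency between a vertex of a ball
    and a vertex outside the next larger ball depends only on their adjacency to boundedly
    many parameters.  In one growing step, each vertex looks to all but boundedly many balls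
    like a member of a bounded sample (otherwise there is a half graph or a configuration);
    the exceptional indices of a vertex can then be reduced to one, for otherwise "having
    both [i] and [j] as exceptional indices" yields a configuration.

    Finally take [i < j] whose tuples have the same local type of rank [q].  In the
    Ehrenfeucht-Fraisse game, exchanging the balls of [i] and [j] and fixing all distant
    vertices is a winning strategy, so the formula cannot distinguish [(i, j)] from [(j, i)]. *)

(** * Ramsey-type lemmas *)

Lemma finite_bound (T : finType) (P : T -> nat -> Prop) :
  (forall x m n, m <= n -> P x m -> P x n) ->
  (forall x, exists n, P x n) -> exists n, forall x, P x n.
Proof.
move=> mono /choice [f fP]; exists (\max_x f x) => x.
by apply: mono (fP x); apply: leq_bigmax.
Qed.

Lemma pigeonhole_count (A : finType) (B : finType) (f : A -> B) (b0 : B) t :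
  t * #|B| <= #|A| -> exists b, exists2 g : 'I_t -> A, injective g & forall i, f (g i) = b.
Proof.
move=> le_tBA.
have [b tb] : exists b, t <= #|[set a | f a == b]|.
  apply: contrapT => /forallNP small.
  case: t le_tBA small => [|t] le small; first by apply: (small b0).
  have: #|A| <= t * #|B|.
    rewrite -[#|A|]cardsT -sum1_card (partition_big f xpredT) //=.
    rewrite mulnC -sum_nat_const; apply: leq_sum => b _.
    rewrite sum1dep_card -ltnS ltnNge; apply/negP => H; apply: (small b).
    by apply: leq_trans H _; apply: subset_leq_card; apply/subsetP => a; rewrite !inE.
  have Bpos : 0 < #|B| by apply/card_gt0P; exists b0.
  nia.
exists b.
have [s s_uniq [s_sub s_size]] : exists2 s : seq A, uniq s & {subset s <= [set a | f a == b]} /\ size s = t.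
  exists (take t (enum [set a | f a == b])); first by rewrite take_uniq ?enum_uniq.
  split; first by move=> x /mem_take; rewrite mem_enum.
  by rewrite size_takel // -cardE.
have s_lt (i : 'I_t) : i < size s by rewrite s_size.
have x0 : 'I_t -> A by move=> i; case: s s_lt {s_uniq s_sub s_size} => [/(_ i)//|x *]; exact: x.
exists (fun i => nth (x0 i) s i).
  move=> i j; rewrite (set_nth_default (x0 i) (x0 j)) // => /eqP.
  by rewrite nth_uniq // => /eqP/val_inj.
by move=> i; have := s_sub _ (mem_nth (x0 i) (s_lt i)); rewrite inE => /eqP.
Qed.

Lemma subseq_sorted_sub (r s : seq nat) :
  sorted ltn r -> sorted ltn s -> {subset r <= s} -> subseq r s.
Proof.
move=> rs ss sub.
suff -> : r = filter (mem r) s by apply: filter_subseq.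
apply: (irr_sorted_eq ltn_trans ltnn) => //; first exact: (sorted_filter ltn_trans).
by move=> x; rewrite mem_filter /=; case: (boolP (x \in r)) => // /sub ->.
Qed.

(** Erdos-Rado argument by induction on [k]: first pass to a sequence where the colour of [k.+1]
    indices depends only on the smallest one, then apply the pigeonhole principle to the resulting
    colouring of single indices. *)
Lemma ramsey_aux k (T : finType) n : exists N, forall (c : seq nat -> T) (s : seq nat),
  uniq s -> N <= size s -> exists s' t, [/\ subseq s' s, size s' = n &
    forall r, subseq r s' -> size r = k -> c r = t].
Proof.
elim: k n => [|k IHk] n.
  exists n => c s _ ns; exists (take n s), (c [::]); split.
  - exact: take_subseq.
  - by rewrite size_takel.
  - by move=> r _ /size0nil ->.
have pre L : exists N, forall (c : seq nat -> T) (s : seq nat), uniq s -> N <= size s ->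
    exists s' (g : nat -> T), [/\ subseq s' s, size s' = L &
      forall x r, subseq (x :: r) s' -> size r = k -> c (x :: r) = g x].
  elim: L => [|L [N IHN]].
    exists 0 => c s _ _; exists [::], (fun=> c [::]); split => //; exact: sub0seq.
  have [N' N'P] := IHk N.
  exists N'.+1 => c [|x s] //= /andP[xs us] ltN.
  have [s1 [t [s1s s1N ct]]] := N'P (fun r => c (x :: r)) s us ltN.
  have us1 := subseq_uniq s1s us.
  have [s2 [g [s2s1 s2L cg]]] := IHN c s1 us1 (eq_leq (esym s1N)).
  have xs2 : x \notin s2.
    by apply: contra xs => /(mem_subseq s2s1)/(mem_subseq s1s).
  exists (x :: s2), (fun y => if y == x then t else g y); split => /=.
  - by rewrite eqxx (subseq_trans s2s1).
  - by rewrite s2L.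
  - move=> y r; case: eqP => [-> rs2 rk|_ yrs2 rk].
      by apply: ct => //; apply: subseq_trans s2s1.
    by apply: cg.
have [N NP] := pre (n * #|T|).
exists N => c s us Ns.
have [s1 [g [s1s s1size cg]]] := NP c s us Ns.
have us1 := subseq_uniq s1s us.
have [|b [f f_inj fb]] := @pigeonhole_count 'I_(n * #|T|) T (fun i => g (nth 0 s1 i)) (c [::]) n.
  by rewrite card_ord.
set F := filter (fun x => g x == b) s1.
have Fn : n <= size F.
  have sub : {subset [seq nth 0 s1 (f i) | i <- enum 'I_n] <= F}.
    move=> _ /mapP[i _ ->]; rewrite mem_filter fb eqxx mem_nth //.
    by rewrite s1size.
  have := uniq_leq_size _ sub; rewrite size_map -cardE card_ord; apply.
  rewrite map_inj_uniq ?enum_uniq // => i j /eqP.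
  by rewrite nth_uniq ?s1size // => /eqP/val_inj/f_inj.
exists (take n F), b; split.
- by apply: subseq_trans (take_subseq _ _) _; apply: subseq_trans s1s; apply: filter_subseq.
- by rewrite size_takel.
- move=> [|x r] // sub [rk].
  have sub' : subseq (x :: r) F by apply: subseq_trans sub (take_subseq _ _).
  have := mem_subseq sub' (mem_head _ _); rewrite mem_filter => /andP[/eqP <- _].
  by apply: cg => //; apply: subseq_trans sub' (filter_subseq _ _).
Qed.

Lemma ramsey k (T : finType) n : exists N, forall (c : seq nat -> T) (s : seq nat),
  sorted ltn s -> N <= size s -> exists s' t, [/\ subseq s' s, size s' = n &
    forall r, sorted ltn r -> {subset r <= s'} -> size r = k -> c r = t].
Proof.
have [N NP] := ramsey_aux k T n.
exists N => c s ss Ns.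
have us : uniq s by apply: sorted_uniq ss; [exact: ltn_trans|exact: ltnn].
have [s' [t [sub sz H]]] := NP c s us Ns.
exists s', t; split => // r rs rsub; apply: H; apply: subseq_sorted_sub => //.
exact: (subseq_sorted ltn_trans sub).
Qed.

Lemma count_sub_in (A : eqType) (p q : pred A) (s : seq A) :
  {in s, forall x, p x -> q x} -> count p s <= count q s.
Proof.
elim: s => [|x s IH] //= H; apply: leq_add; last by apply: IH => y ys; apply: H; rewrite inE ys orbT.
by case px: (p x) => //; rewrite (H x (mem_head _ _) px).
Qed.

Lemma count_negb (A : Type) (p : pred A) (s : seq A) :
  count (fun x => ~~ p x) s + count p s = size s.
Proof. by rewrite addnC -(count_predC p s). Qed.

Lemma count_has_le (A B : eqType) (r : A -> pred B) (L : seq A) (s : seq B) c :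
  (forall x, x \in L -> count (r x) s <= c) ->
  count (fun i => has (fun x => r x i) L) s <= size L * c.
Proof.
elim: L => [|x L IH] H /=; first by rewrite count_pred0.
rewrite mulSn; apply: leq_trans (_ : count (predU (r x) (fun i => has (fun x => r x i) L)) s <= _).
  by apply: sub_count => i.
have := count_predUI (r x) (fun i => has (fun x => r x i) L) s.
have := H x (mem_head _ _).
have := IH (fun y yL => H y (@mem_behead _ (x :: L) y yL)).
lia.
Qed.

(** By Ramsey for triples, [g] depends only on whether the third index lies after, between or before
    the pair. If one of these three values were true, a suitable pair would have all other indices
    as exceptions. *)
Lemma free_set c n : exists N, forall (g : nat -> nat -> pred nat) (s : seq nat),
  sorted ltn s -> N <= size s ->
  (forall i j, i \in s -> j \in s -> i < j -> count (g i j) s <= c) ->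
  exists s', [/\ subseq s' s, size s' = n &
    forall i j l, i \in s' -> j \in s' -> l \in s' -> i < j -> g i j l -> l = i \/ l = j].
Proof.
have [N NP] := ramsey 3 ((bool * bool) * bool)%type (maxn n (c + 3)).
exists N => g s ss Ns gc.
pose col (r : seq nat) := let a := nth 0 r 0 in let b := nth 0 r 1 in let d := nth 0 r 2 in
  (g a b d, g a d b, g b d a).
have [s1 [[[t1 t2] t3] [s1s s1sz H]]] := NP col s ss Ns.
have ss1 : sorted ltn s1 by apply: (subseq_sorted ltn_trans s1s).
have us1 : uniq s1 by apply: sorted_uniq ss1; [exact: ltn_trans|exact: ltnn].
have mem1 := mem_subseq s1s.
have H3 a b d : a \in s1 -> b \in s1 -> d \in s1 -> a < b -> b < d ->
    [/\ g a b d = t1, g a d b = t2 & g b d a = t3].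
  move=> a1 b1 d1 ab bd; have := H [:: a; b; d]; rewrite /= ab bd => /(_ isT) H'.
  have /H' : {subset [:: a; b; d] <= s1} by move=> x; rewrite !inE => /or3P[]/eqP->.
  by move=> /(_ erefl) [].
(* With at least [c + 3] indices in [s1], discarding the two in [e] still leaves more than [c]. *)
have big (e : seq nat) i j : i \in s1 -> j \in s1 -> i < j -> size e <= 2 ->
    (forall l, l \in s1 -> l \notin e -> g i j l) -> False.
  move=> i1 j1 ij e2 Hl.
  have := gc i j (mem1 _ i1) (mem1 _ j1) ij; apply/negP; rewrite -ltnNge.
  apply: leq_trans (leq_count_subseq _ s1s).
  have : count (predC (mem e)) s1 <= count (g i j) s1.
    by apply: count_sub_in => l l1 /=; apply: Hl.
  apply: leq_trans.
  have := count_predC (mem e) s1.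
  have : count (mem e) s1 <= 2.
    apply: leq_trans e2; rewrite -size_filter; apply: uniq_leq_size; first exact: filter_uniq.
    by move=> x; rewrite mem_filter => /andP[].
  by rewrite s1sz; lia.
have sz3 : 2 < size s1 by rewrite s1sz; lia.
have nth_lt a b : a < b -> b < size s1 -> nth 0 s1 a < nth 0 s1 b.
  by move=> ab bs; apply: (sorted_ltn_nth ltn_trans) => //; apply: ltn_trans bs.
have ms q : q < size s1 -> nth 0 s1 q \in s1 by exact: mem_nth.
(* The first two indices leave all others above them; the next two steps use the last two indices,
   then the outermost two. *)
have F1 : t1 = false.
  apply/negP => T.
  apply: (big [:: nth 0 s1 0; nth 0 s1 1] (nth 0 s1 0) (nth 0 s1 1)) => //.
  - by apply: ms; lia.
  - by apply: ms; lia.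
  - by apply: nth_lt => //; lia.
  move=> l /(nthP 0)[q qs <-] nl.
  have q1 : 1 < q by case: q qs nl => [|[|q]] // qs; rewrite !inE eqxx ?orbT.
  have [|||||e1 e2 e3] := H3 (nth 0 s1 0) (nth 0 s1 1) (nth 0 s1 q);
    last (by rewrite e1); by [apply: ms; lia|apply: nth_lt; lia].
have F3 : t3 = false.
  apply/negP => T; set m := size s1.
  apply: (big [:: nth 0 s1 m.-2; nth 0 s1 m.-1] (nth 0 s1 m.-2) (nth 0 s1 m.-1)) => //.
  - by apply: ms; lia.
  - by apply: ms; lia.
  - by apply: nth_lt; lia.
  move=> l /(nthP 0)[q qs <-] nl.
  have q2 : q < m.-2 by move: nl; rewrite !inE !nth_uniq; lia.
  have [|||||e1 e2 e3] := H3 (nth 0 s1 q) (nth 0 s1 m.-2) (nth 0 s1 m.-1);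
    last (by rewrite e3); by [apply: ms; lia|apply: nth_lt; lia].
have F2 : t2 = false.
  apply/negP => T; set m := size s1.
  apply: (big [:: nth 0 s1 0; nth 0 s1 m.-1] (nth 0 s1 0) (nth 0 s1 m.-1)) => //.
  - by apply: ms; lia.
  - by apply: ms; lia.
  - by apply: nth_lt; lia.
  move=> l /(nthP 0)[q qs <-] nl.
  have [q0 q2] : 0 < q /\ q < m.-1 by move: nl; rewrite !inE !nth_uniq; lia.
  have [|||||e1 e2 e3] := H3 (nth 0 s1 0) (nth 0 s1 q) (nth 0 s1 m.-1);
    last (by rewrite e2); by [apply: ms; lia|apply: nth_lt; lia].
exists (take n s1); split.
- by apply: subseq_trans (take_subseq _ _) s1s.
- by rewrite size_takel // s1sz leq_maxl.
- move=> i j l /mem_take i1 /mem_take j1 /mem_take l1 ij gl.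
  case: (ltngtP l i) => [li|il|]; last by left.
    by have [_ _] := H3 _ _ _ l1 i1 j1 li ij; rewrite gl F3.
  case: (ltngtP l j) => [lj|jl|]; last by right.
    by have [_] := H3 _ _ _ i1 l1 j1 il lj; rewrite gl F2.
  by have [] := H3 _ _ _ i1 j1 l1 ij jl; rewrite gl F1.
Qed.

(** * Relativized definability and iterated neighbourhoods *)

(** Bounding quantifiers by [X] evaluates formulas in an induced subgraph without changing the
    vertex type; the environment itself may leave [X]. *)
Fixpoint satR (G : graph) (X : {set gV G}) n (phi : formula n) : ('I_n -> gV G) -> Prop :=
  match phi in formula m return ('I_m -> gV G) -> Prop with
  | FEdge _ i j => fun e => gE (e i) (e j)
  | FEq _ i j => fun e => e i = e j
  | FNot _ f => fun e => ~ satR X f e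
  | FAnd _ f g => fun e => satR X f e /\ satR X g e
  | FEx _ f => fun e => exists2 x : gV G, x \in X & satR X f (ext_env x e)
  end.

Lemma ext_env_comp (A B : Type) (h : A -> B) n (x : A) (e : 'I_n -> A) :
  h \o ext_env x e = ext_env (h x) (h \o e).
Proof. by apply: funext => i; rewrite /= /ext_env; case: unlift. Qed.

Lemma sat_embed (H G : graph) (h : gV H -> gV G) (X : {set gV G}) :
  injective h -> (forall x y, gE (h x) (h y) = gE x y) ->
  (forall y, reflect (exists x, y = h x) (y \in X)) ->
  forall n (phi : formula n) (e : 'I_n -> gV H), sat phi e <-> satR X phi (h \o e).
Proof.
move=> h_inj hE hX n phi; elim: phi => {n} [n i j|n i j|n f IH|n f IHf g IHg|n f IH] e /=.
- by rewrite hE.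
- by split=> [->|/h_inj].
- by rewrite IH.
- by rewrite IHf IHg.
- split=> [[x]|[y /hX[x ->]]].
    by rewrite IH ext_env_comp => ?; exists (h x) => //; apply/hX; exists x.
  by rewrite -ext_env_comp -IH; exists x.
Qed.

Definition lift_var n n' (f : 'I_n -> 'I_n') (i : 'I_n.+1) : 'I_n'.+1 :=
  if unlift ord0 i is Some j then lift ord0 (f j) else ord0.

Fixpoint rename n (phi : formula n) : forall n', ('I_n -> 'I_n') -> formula n' :=
  match phi in formula m return forall n', ('I_m -> 'I_n') -> formula n' with
  | FEdge _ i j => fun _ f => FEdge (f i) (f j)
  | FEq _ i j => fun _ f => FEq (f i) (f j)
  | FNot _ p => fun _ f => FNot (rename p f)
  | FAnd _ p q => fun _ f => FAnd (rename p f) (rename q f)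
  | FEx _ p => fun _ f => FEx (rename p (lift_var f))
  end.

Lemma ext_env_lift (V : Type) n n' (f : 'I_n -> 'I_n') (x : V) (e : 'I_n' -> V) :
  ext_env x e \o lift_var f = ext_env x (e \o f).
Proof.
apply: funext => i; rewrite /= /ext_env /lift_var.
by case: (unlift ord0 i) => [j|]; rewrite ?liftK ?unlift_none.
Qed.

Lemma satR_rename (G : graph) (X : {set gV G}) n (phi : formula n) n' (f : 'I_n -> 'I_n')
  (e : 'I_n' -> gV G) : satR X (rename phi f) e <-> satR X phi (e \o f).
Proof.
elim: phi n' f e => {n} [n i j|n i j|n p IH|n p IHp q IHq|n p IH] n' f e //=.
- by rewrite IH.
- by rewrite IHp IHq.
- by split=> -[x xX H]; exists x => //; move: H; rewrite IH ext_env_lift.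
Qed.

(* The set argument is the range of the quantifiers. *)
Definition gpred (I : Type) := forall G : graph, {set gV G} -> (I -> gV G) -> Prop.

(** One formula serves all [G], [X] and [e]. Variables are indexed by any finite type, so that
    formulas arise from closure properties instead of de Bruijn arithmetic. *)
Definition definable (I : finType) (P : gpred I) : Prop :=
  exists phi : formula #|I|, forall (G : graph) (X : {set gV G}) (e : I -> gV G),
    satR X phi (e \o enum_val) <-> P G X e.

Definition oext (I V : Type) (x : V) (e : I -> V) (i : option I) : V :=
  if i is Some j then e j else x.

Definition sumf (I I' V : Type) (u : I -> V) (v : I' -> V) (i : I + I') : V :=
  match i with inl a => u a | inr b => v b end.

Section Definable.
Implicit Types I : finType.

Lemma definable_ext I (P Q : gpred I) :
  (forall G X e, P G X e <-> Q G X e) -> definable P -> definable Q.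
Proof. by move=> PQ [phi H]; exists phi => G X e; rewrite H PQ. Qed.

Lemma definable_edge I (i j : I) : definable (fun G X (e : I -> gV G) => gE (e i) (e j)).
Proof. by exists (FEdge (enum_rank i) (enum_rank j)) => G X e /=; rewrite !enum_rankK. Qed.

Lemma definable_eq I (i j : I) : definable (fun G X (e : I -> gV G) => e i = e j).
Proof. by exists (FEq (enum_rank i) (enum_rank j)) => G X e /=; rewrite !enum_rankK. Qed.

Lemma definable_not I (P : gpred I) : definable P -> definable (fun G X e => ~ P G X e).
Proof. by move=> [phi H]; exists (FNot phi) => G X e /=; rewrite H. Qed.

Lemma definable_and I (P Q : gpred I) :
  definable P -> definable Q -> definable (fun G X e => P G X e /\ Q G X e).
Proof. by move=> [phi H] [psi K]; exists (FAnd phi psi) => G X e /=; rewrite H K. Qed.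

Lemma definable_or I (P Q : gpred I) :
  definable P -> definable Q -> definable (fun G X e => P G X e \/ Q G X e).
Proof.
move=> dP dQ; apply: definable_ext (definable_not (definable_and (definable_not dP) (definable_not dQ))).
by move=> G X e /=; rewrite not_andE !notK.
Qed.

(** The language has no truth constants: [i] provides the atom [e i = e i]. *)
Lemma definable_const I (b : Prop) : I -> definable (fun G X (e : I -> gV G) => b).
Proof.
move=> i; have T : definable (fun G X (e : I -> gV G) => e i = e i) by exact: definable_eq.
case: (pselect b) => hb; first by apply: definable_ext T => G X e; split.
by apply: definable_ext (definable_not T) => G X e; split=> // /(_ erefl).
Qed.

Lemma definable_ex I (P : gpred (option I)) :
  definable P -> definable (fun G X (e : I -> gV G) => exists2 x, x \in X & P G X (oext x e)).
Proof.
move=> [phi H].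
pose f (i : 'I_#|{: option I}|) : 'I_#|I|.+1 :=
  if enum_val i is Some j then lift ord0 (enum_rank j) else ord0.
exists (FEx (rename phi f)) => G X e /=.
have eqe x : ext_env x (e \o enum_val) \o f = oext x e \o enum_val.
  apply: funext => i; rewrite /= /ext_env /f.
  by case: (enum_val i) => [j|] /=; rewrite ?liftK ?unlift_none //= enum_rankK.
by split=> -[x xX K]; exists x => //; move: K; rewrite satR_rename eqe H.
Qed.

Lemma definable_all_fin I (T : finType) (P : T -> gpred I) : I ->
  (forall t, definable (P t)) -> definable (fun G X e => forall t, P t G X e).
Proof.
move=> i dP.
suff: forall s : seq T, definable (fun G X (e : I -> gV G) => forall t, t \in s -> P t G X e).
  move=> /(_ (enum T)); apply: definable_ext => G X e; split=> H t; last by move=> _.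
  by apply: H; rewrite mem_enum.
elim=> [|t s IH]; first by apply: definable_ext (definable_const True i) => G X e; split.
apply: definable_ext (definable_and (dP t) IH) => G X e; split.
  by move=> [Pt Ps] u; rewrite inE => /predU1P[->|/Ps].
by move=> H; split=> [|u us]; apply: H; rewrite inE ?eqxx ?us ?orbT.
Qed.

Lemma definable_ex_fin I (T : finType) (P : T -> gpred I) : I ->
  (forall t, definable (P t)) -> definable (fun G X e => exists t, P t G X e).
Proof.
move=> i dP; have := definable_not (definable_all_fin i (fun t => definable_not (dP t))).
by apply: definable_ext => G X e; rewrite forallNE notK.
Qed.

End Definable.

Section Reach.
Variable J : finType.

(** A link is the pattern of a flip, not necessarily symmetric: toggling adjacency on the pairs of
    types where it is true leaves the relation [mis], and [reach] explores balls through successive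
    flips. *)
Definition link := {ffun {set J} * {set J} -> bool}.

Definition tp (G : graph) (s : J -> gV G) (x : gV G) : {set J} := [set j | gE x (s j)].

(* [F] predicts the adjacency of [x] and [z]; [mis] says that the prediction fails. *)
Definition mis (G : graph) (s : J -> gV G) (F : link) (x z : gV G) : bool :=
  gE x z != F (tp s x, tp s z).

Variable W : finType.

(* The head of [Fs] is the link of the last step. *)
Fixpoint reach (G : graph) (X : {set gV G}) (w : W -> gV G) (s : J -> gV G) (Fs : seq link)
    (z : gV G) : bool :=
  if Fs is F :: Fs' then
    reach X w s Fs' z || [exists x in X, reach X w s Fs' x && mis s F x z]
  else [exists a, z == w a].

Lemma reach_mono (G : graph) (X Y : {set gV G}) w s Fs z :
  X \subset Y -> reach X w s Fs z -> reach Y w s Fs z.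
Proof.
move=> XY; elim: Fs z => [|F Fs IH] z //= /orP[/IH-> //|/exists_inP[x xX /andP[/IH rx m]]].
by apply/orP; right; apply/exists_inP; exists x; rewrite ?rx ?(subsetP XY).
Qed.

Lemma reach_chain (G : graph) (w : W -> gV G) s Fs z : reach setT w s Fs z ->
  exists c : seq (gV G), [/\ size c = (size Fs).+1, z \in c,
    {in c, forall v, reach setT w s Fs v} &
    forall X : {set gV G}, {subset c <= X} -> reach X w s Fs z].
Proof.
elim: Fs z => [|F Fs IH] z /=.
  by move=> zw; exists [:: z]; split=> //; [rewrite mem_head|move=> v; rewrite inE => /eqP->].
case/orP=> [rz|/exists_inP[x _ /andP[rx m]]].
  have [c [sc zc cr cX]] := IH _ rz; exists (z :: c); split=> /=.
  - by rewrite sc.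
  - exact: mem_head.
  - by move=> v; rewrite inE => /predU1P[->|/cr->]; rewrite ?rz.
  - by move=> X sub; rewrite cX // => v vc; apply: sub; rewrite inE vc orbT.
have [c [sc zc cr cX]] := IH _ rx; exists (z :: c); split=> /=.
- by rewrite sc.
- exact: mem_head.
- move=> v; rewrite inE => /predU1P[->|/cr->] //; apply/orP; right.
  by apply/exists_inP; exists x; rewrite ?rx.
- move=> X sub; apply/orP; right; apply/exists_inP.
  have subc : {subset c <= X} by move=> v vc; apply: sub; rewrite inE vc orbT.
  by exists x; rewrite ?cX ?subc.
Qed.

Lemma definable_tp (I : finType) (i : I) (s : J -> I) (t : {set J}) :
  definable (fun G X (e : I -> gV G) => tp (e \o s) (e i) = t).
Proof.
apply: (definable_ext (P := fun G X (e : I -> gV G) => forall j, if j \in t then is_true (gE (e i) (e (s j)))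
  else ~ gE (e i) (e (s j)))).
  move=> G X e; split=> [H|<- j].
    apply/setP => j; rewrite inE /=; by have := H j; case: (j \in t) => // /negP/negbTE.
  by rewrite inE /=; case: gE.
apply: definable_all_fin => // j; case: (j \in t); last apply: definable_not; exact: definable_edge.
Qed.

Lemma definable_mis (I : finType) (i i' : I) (s : J -> I) F :
  definable (fun G X (e : I -> gV G) => mis (e \o s) F (e i) (e i')).
Proof.
have Q (b : bool) : definable (fun G X (e : I -> gV G) => F (tp (e \o s) (e i), tp (e \o s) (e i')) = b).
  apply: (definable_ext (P := fun G X (e : I -> gV G) => exists t : {set J} * {set J},
    (F t = b /\ tp (e \o s) (e i) = t.1) /\ tp (e \o s) (e i') = t.2)).
    move=> G X e; split=> [[[t t'] /= [[<- ->] ->]] //|Fb].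
    by exists (tp (e \o s) (e i), tp (e \o s) (e i')).
  apply: definable_ex_fin => // t; apply: definable_and; last exact: definable_tp.
  by apply: definable_and; [exact: definable_const|exact: definable_tp].
apply: definable_ext (definable_or
  (definable_and (definable_edge i i') (Q false))
  (definable_and (definable_not (definable_edge i i')) (Q true))) => G X e.
by rewrite /mis /=; case: gE; case: (F _); split=> [[[? ?]|[? ?]]|?] //; by [left|right].
Qed.

Lemma definable_reach (I : finType) (w : W -> I) (s : J -> I) (i : I) Fs :
  definable (fun G X (e : I -> gV G) => reach X (e \o w) (e \o s) Fs (e i)).
Proof.
(* The variable type varies in the induction because each step quantifies one more vertex. *)
elim: Fs I w s i => [|F Fs IH] I w s i /=.
  apply: (definable_ext (P := fun G X (e : I -> gV G) => exists a, e i = e (w a))).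
    by move=> G X e; split=> [[a H]|/existsP[a /eqP H]]; [apply/existsP; exists a; apply/eqP|exists a].
  by apply: definable_ex_fin => // a; exact: definable_eq.
have := definable_or (IH I w s i) (definable_ex (definable_and
  (IH (option I) (Some \o w) (Some \o s) None) (definable_mis None (Some i) (Some \o s) F))).
apply: definable_ext => G X e /=; split.
  case=> [->//|[x xX [rx mx]]]; apply/orP; right; apply/exists_inP; exists x => //.
  by apply/andP.
by case/orP=> [|/exists_inP[x xX /andP[rx mx]]]; [left|right; exists x].
Qed.

End Reach.

(** * Grid configurations and half graphs *)

(** Nothing is prescribed when only some of the witnesses of a cell are in [X]. Keeping all rows and
    columns, but the witnesses of selected cells only, realizes any bipartite pattern on the
    grid. *)
Definition config (I I' K : finType) (P : gpred (I + I')) (n : nat) (G : graph) : Prop :=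
  exists (a : 'I_n -> I -> gV G) (b : 'I_n -> I' -> gV G) (p : 'I_n -> 'I_n -> K -> gV G),
  forall (i j : 'I_n) (X : {set gV G}),
    ((forall x, a i x \in X) -> (forall x, b j x \in X) -> (forall x, p i j x \in X) ->
       P G X (sumf (a i) (b j))) /\
    ((forall v, v \in X -> [\/ exists i' x, v = a i' x, exists j' x, v = b j' x |
         exists i' j' x, (i', j') <> (i, j) /\ v = p i' j' x]) ->
       ~ P G X (sumf (a i) (b j))).

Definition no_config (C : gclass) : Prop :=
  forall (I I' K : finType) (P : gpred (I + I')), definable P ->
  exists n, forall G, C G -> ~ config K P n G.

Lemma config_mono (I I' K : finType) (P : gpred (I + I')) m n G :
  m <= n -> config K P n G -> config K P m G.
Proof.
move=> mn [a [b [p H]]]; pose f := widen_ord mn.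
have f_inj : injective f by move=> i j /(congr1 val) /= /val_inj.
exists (a \o f), (b \o f), (fun i j => p (f i) (f j)) => i j X.
have [H1 H2] := H (f i) (f j) X; split=> // HX; apply: H2 => v /HX.
case=> [[i' [x ->]]|[j' [x ->]]|[i' [j' [x [ne ->]]]]].
- by apply: Or31; exists (f i'), x.
- by apply: Or32; exists (f j'), x.
- apply: Or33; exists (f i'), (f j'), x; split=> // -[/val_inj e1 /val_inj e2].
  by apply: ne; rewrite e1 e2.
Qed.

(** Taking fourth powers reduces the claim to [A ^ 5 * n ^ 2 <= n ^ 4], true once [n] is at least
    [A ^ 5]. In the applications [A * n ^ 2] bounds the number of vertices of a structure of order
    [n]. *)
Lemma subpoly_bound (f : nat -> nat) : subpoly f ->
  forall A a, exists N, forall n, N <= n -> A * f (A * n ^ 2) ^ a.+1 <= n.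
Proof.
move=> sf A a; have [|N NP] := sf (a.+1 * 4); first by rewrite muln_gt0.
case: A => [|A]; first by exists 0.
exists (maxn N (A.+1 ^ 5)) => n; rewrite geq_max => /andP[Nn An].
have n0 : 0 < n by apply: leq_trans An; rewrite expn_gt0.
have /NP : N <= A.+1 * n ^ 2 by nia.
rewrite expnM => H; rewrite -(leq_exp2r _ _ (e := 4)) // expnMn.
apply: leq_trans (_ : A.+1 ^ 4 * (A.+1 * n ^ 2) <= _); first by rewrite leq_mul2l H orbT.
rewrite mulnA -expnSr (_ : n ^ 4 = n ^ 2 * n ^ 2); last by rewrite -expnD.
by rewrite leq_mul2r; apply/orP; right; apply: leq_trans An _; rewrite -{1}[n]expn1 leq_pexp2l.
Qed.

(* Pigeonhole on t * #|T| rows in every column, then on the columns. *)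
Lemma mono_grid (T : finType) (t0 : T) t t' N (c : 'I_N -> 'I_N -> T) :
  t * #|T| <= N -> t' * (#|T| * (t * #|T|) ^ t) <= N ->
  exists tau, exists2 r : 'I_t -> 'I_N, injective r &
    exists2 s : 'I_t' -> 'I_N, injective s & forall i j, c (r i) (s j) = tau.
Proof.
set m := t * #|T| => mN colN; pose w := widen_ord mN.
(* Each column records a frequent colour and [t] rows carrying it; there are only [#|T| * m ^ t]
   records, so many columns share one. *)
have /choice [h hP] : forall j, exists q : T * {ffun 'I_t -> 'I_m},
    injective q.2 /\ forall i, c (w (q.2 i)) j = q.1.
  move=> j; have [|tau [g g_inj gc]] := pigeonhole_count (fun i => c (w i) j) t0 (t := t).
    by rewrite card_ord.
  exists (tau, finfun g); split=> [x y|i] /=; rewrite ?ffunE ?gc //.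
  exact: g_inj.
case: t' colN => [|t'] colN.
  have [|tau [g g_inj _]] := @pigeonhole_count 'I_m T (fun _ => t0) t0 t; first by rewrite card_ord.
  exists t0, (w \o g); first by move=> x y /(congr1 val) /= /val_inj /g_inj.
  by have s0 : 'I_0 -> 'I_N by [case]; exists s0 => [[]|? []].
have [q0 _] : exists q0 : T * {ffun 'I_t -> 'I_m}, True.
  case: N c mN colN w h hP => [|N] c mN colN w h hP; last by exists (h ord0).
  move: colN; rewrite mulSn; case: t @m mN w h hP => [|t] m mN w h hP.
    by have s0 : 'I_0 -> 'I_m by [case]; exists (t0, finfun s0).
  have : 0 < #|T| by apply/card_gt0P; exists t0.
  by move: mN; rewrite /m; nia.
have [|q [g g_inj gq]] := pigeonhole_count h q0 (t := t'.+1).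
  by rewrite card_prod card_ffun !card_ord.
exists q.1, (w \o q.2).
  have [q_inj _] := hP (g ord0); rewrite gq in q_inj *.
  by move=> x y /(congr1 val) /= /val_inj /q_inj.
by exists g => // i j; have [_] := hP (g j); rewrite gq => /(_ i).
Qed.

Definition to_induced (G : graph) (S : {set gV G}) x (xS : x \in S) : gV (induced S) :=
  exist _ x xS.

(** Colour each cell of a large grid by the parts of its row, column and witness vertices. The grid
    spans quadratically many vertices, so subpolynomially many parts leave a monochromatic subgrid
    with [2 ^ n] columns. It meets at most [#|S|] parts, hence induces a member of [D], where
    deleting witnesses makes the formula independent. *)
Lemma no_config_of_NIP_decomp (C : gclass) : hereditary C ->
  (forall p : nat, 0 < p -> exists (D : gclass) (f : nat -> nat),
     hereditary D /\ NIP D /\ nondecreasing f /\ subpoly f /\ has_decomp C D f p) ->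
  no_config C.
Proof.
move=> [_ Cind] dec I I' K P [phi0 phi0P].
apply: contrapT => /forallNP noc.
have {}noc n : exists2 G, C G & config K P n G.
  by apply: contrapT => H; apply: (noc n) => G CG cf; apply: H; exists G.
pose S : finType := (I + I' + K)%type.
(* With no variables and no witnesses the parameter would be 0; but then both clauses of [config]
   apply to [set0] and contradict each other. *)
case: (posnP #|S|) => [S0|Spos].
  have [G CG [a [b [p H]]]] := noc 1.
  have noS (x : S) : False by have := card0_eq S0 x.
  have [H1 H2] := H ord0 ord0 set0.
  apply: H2; first by move=> v; rewrite inE.
  by apply: H1 => x; [case: (noS (inl (inl x)))|case: (noS (inl (inr x)))|case: (noS (inr x))].
have [D [f [[_ Dind] [nipD [fmono [fsub dec']]]]]] := dec _ Spos.
apply: nipD; pose k := #|I|; pose l := #|I'|.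
pose rho (i : 'I_#|{: I + I'}|) : 'I_(k + l) :=
  match enum_val i with inl x => lshift l (enum_rank x) | inr x => rshift k (enum_rank x) end.
exists k, l, (rename phi0 rho) => n.
(* The spare row places the column vertices in some cell even when [n = 0]; there is one column per
   subset of ['I_n]. *)
pose t := n.+1; pose t' := #|{set 'I_n}|; pose c := #|S|.
(* [c] serves the vertex count, [t] and [t' * t ^ t] the two size conditions of [mono_grid]. *)
pose A := t + t' * t ^ t + c.
have [N0 N0P] := subpoly_bound fsub A (c * t.+1).
pose N := maxn N0 A; have NA : A <= N by rewrite leq_maxr.
have [G CG [a [b [p H]]]] := noc N.
pose el (i j : 'I_N) (x : S) : gV G :=
  match x with inl (inl y) => a i y | inl (inr y) => b j y | inr y => p i j y end.
pose X0 := [set el q.1.1 q.1.2 q.2 | q : 'I_N * 'I_N * S].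
have elX i j x : el i j x \in X0 by apply/imsetP; exists (i, j, x).
have szX0 : gsize (induced X0) <= A * N ^ 2.
  rewrite /gsize /= card_sig; apply: leq_trans (leq_imset_card _ _) _.
  by rewrite !card_prod card_ord -/c mulnC (_ : N ^ 2 = N * N) // leq_mul2r; apply/orP; right; rewrite /A; lia.
have [K0 [K0f [part partP]]] := dec' _ (Cind _ X0 CG).
pose q i j x := to_induced (elX i j x).
have Npos : 0 < N by rewrite /A /t in NA *; lia.
pose col i j : {ffun S -> 'I_K0} := [ffun x => part (q i j x)].
have K0N e : e <= (c * t.+1).+1 -> A * K0 ^ e <= N.
  move=> le_e; case: (posnP K0) => [->|K0pos].
    by apply: leq_trans NA; rewrite -{2}[A]muln1 leq_mul2l; case: e {le_e} => [|e]; rewrite ?expn0 ?exp0n ?orbT.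
  have := N0P N (leq_maxl _ _); apply: leq_trans; rewrite leq_mul2l; apply/orP; right.
  apply: leq_trans (_ : K0 ^ (c * t.+1).+1 <= _); first by rewrite leq_pexp2l.
  by rewrite leq_exp2r //; apply: leq_trans K0f _; apply: fmono.
have [||tau [r r_inj [s s_inj rs]]] := @mono_grid _ (col (Ordinal Npos) (Ordinal Npos)) t t' N col.
- rewrite card_ffun card_ord -/c; apply: leq_trans (K0N c _); last by nia.
  by rewrite leq_mul2r /A; apply/orP; right; lia.
- rewrite card_ffun card_ord -/c expnMn -expnM.
  apply: leq_trans (K0N (c + c * t) _); last by nia.
  rewrite expnD !mulnA (mulnAC t') -!mulnA mulnA.
  by rewrite leq_mul2r /A; apply/orP; right; lia.
pose sel (i : 'I_#|S|) := tau (enum_val i).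
pose T1 := [set x | part x \in [seq sel i | i : 'I_#|S|]].
have qT1 i j x : q (r i) (s j) x \in T1.
  rewrite inE (_ : part _ = sel (enum_rank x)); first exact: map_f (mem_enum _ _).
  by rewrite /sel enum_rankK -(rs i j) ffunE.
pose row (i : 'I_n) := r (widen_ord (leqnSn n) i); pose column (Q : {set 'I_n}) := s (enum_rank Q).
(* Witnesses are kept exactly for the cells [(i, Q)] with [i \in Q]. *)
pose X2 := [set v | [|| [exists i, exists x, v == a (row i) x],
   [exists Q, exists x, v == b (column Q) x] |
   [exists i, exists Q : {set 'I_n}, exists x, (i \in Q) && (v == p (row i) (column Q) x)]]].
pose T2 := [set x : gV (induced T1) | val (val x) \in X2].
pose G' := induced T2; pose h (x : gV G') := val (val (val x)).
have h_inj : injective h by move=> x y /val_inj/val_inj/val_inj.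
have X2el v : v \in X2 -> exists i j x, v = el (r i) (s j) x.
  rewrite inE => /or3P[/existsP[i /existsP[x /eqP->]]|/existsP[Q /existsP[x /eqP->]]|/existsP[i /existsP[Q /existsP[x /andP[_ /eqP->]]]]].
  - by exists (widen_ord (leqnSn n) i), (enum_rank set0), (inl (inl x)).
  - by exists ord0, (enum_rank Q), (inl (inr x)).
  - by exists (widen_ord (leqnSn n) i), (enum_rank Q), (inr x).
have hX v : reflect (exists x, v = h x) (v \in X2).
  apply: (iffP idP) => [vX|[x ->]]; last by have := valP x; rewrite inE.
  have [i [j [x vE]]] := X2el v vX.
  have xT2 : to_induced (qT1 i j x) \in T2 by rewrite inE /= -vE.
  by exists (to_induced xT2).
have pre (B : Type) (g : B -> gV G) : (forall y, g y \in X2) -> exists g' : B -> gV G', h \o g' = g.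
  move=> gX; have /choice[g' g'P] : forall y, exists x, g y = h x by move=> y; apply/hX.
  by exists g'; apply: funext => y /=.
have [|u' u'P] := pre ('I_n * 'I_k)%type (fun z => a (row z.1) (enum_val z.2)).
  by move=> z; rewrite inE; apply/orP; left; apply/existsP; exists z.1; apply/existsP; exists (enum_val z.2).
have [|v' v'P] := pre ({set 'I_n} * 'I_l)%type (fun z => b (column z.1) (enum_val z.2)).
  move=> z; rewrite inE; apply/or3P; apply: Or32; apply/existsP; exists z.1.
  by apply/existsP; exists (enum_val z.2).
exists G'; split; first by apply: Dind; apply: partP.
exists (fun i x => u' (i, x)), (fun Q x => v' (Q, x)) => i Q.
rewrite (sat_embed h_inj _ hX) // satR_rename.
set e := _ \o rho; have -> : e = sumf (a (row i)) (b (column Q)) \o enum_val.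
  apply: funext => z; rewrite /e /= /rho /join_env /=.
  case: (enum_val z) => x /=.
    have -> : split (lshift l (enum_rank x)) = inl (enum_rank x) by exact: (unsplitK (inl _)).
    by have /(congr1 (fun F => F (i, enum_rank x))) /= -> := u'P; rewrite enum_rankK.
  have -> : split (rshift k (enum_rank x)) = inr (enum_rank x) by exact: (unsplitK (inr _)).
  by have /(congr1 (fun F => F (Q, enum_rank x))) /= -> := v'P; rewrite enum_rankK.
rewrite phi0P; have [H1 H2] := H (row i) (column Q) X2; split.
  apply: contraPT => /negP iQ; apply: H2 => v; rewrite inE.
  move=> /or3P[/existsP[i' /existsP[x /eqP->]]|/existsP[Q' /existsP[x /eqP->]]|/existsP[i' /existsP[Q' /existsP[x /andP[iQ' /eqP->]]]]].
  - by apply: Or31; exists (row i'), x.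
  - by apply: Or32; exists (column Q'), x.
  - apply: Or33; exists (row i'), (column Q'), x; split=> // -[/r_inj/(congr1 val)/= /val_inj ei /s_inj/enum_rank_inj eQ].
    by apply: iQ; rewrite -ei -eQ.
move=> iQ; apply: H1 => x; rewrite inE; apply/or3P.
- by apply: Or31; apply/existsP; exists i; apply/existsP; exists x.
- by apply: Or32; apply/existsP; exists Q; apply/existsP; exists x.
- by apply: Or33; apply/existsP; exists i; apply/existsP; exists Q; apply/existsP; exists x; rewrite iQ eqxx.
Qed.

Definition half_graph (h : nat) (G : graph) : Prop :=
  exists u v : 'I_h -> gV G, forall i j, gE (u i) (v j) = (i <= j).

(** Group the indices of a long half graph by the parts of [u i] and [v i]: a large group is a half
    graph inside two parts, so the edge formula would order [S]. *)
Lemma no_half_graph_of_stable_decomp (C S : gclass) (g : nat -> nat) : hereditary C ->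
  hereditary S -> stable S -> nondecreasing g -> subpoly g -> has_decomp C S g 2 ->
  exists h, forall G, C G -> ~ half_graph h G.
Proof.
move=> [_ Cind] [_ Sind] stS gmono gsub dec.
apply: contrapT => /forallNP noh.
have {}noh n : exists2 G, C G & half_graph n G.
  by apply: contrapT => H; apply: (noh n) => G CG hg; apply: H; exists G.
apply: stS; exists 1, 1, (FEdge (lshift 1 ord0) (rshift 1 ord0)) => n.
have [N0 N0P] := subpoly_bound gsub n.+2 1.
pose N := N0.+1.
have [G CG [u [v uv]]] := noh N.
pose X0 := [set u i | i : 'I_N] :|: [set v i | i : 'I_N].
have uX i : u i \in X0 by rewrite inE imset_f.
have vX i : v i \in X0 by rewrite inE imset_f ?orbT.
have szX0 : gsize (induced X0) <= n.+2 * N ^ 2.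
  rewrite /gsize /= card_sig; apply: leq_trans (leq_card_setU _ _) _.
  apply: leq_trans (leq_add (leq_imset_card _ _) (leq_imset_card _ _)) _.
  by rewrite card_ord /N; nia.
have [K0 [K0f [part partP]]] := dec _ (Cind _ X0 CG).
pose u0 i := to_induced (uX i).
pose v0 i := to_induced (vX i).
have [|[c1 c2] [s s_inj sc]] := pigeonhole_count (fun i => (part (u0 i), part (v0 i))) (part (u0 ord0), part (v0 ord0)) (t := n).
  rewrite card_prod !card_ord.
  have := N0P N (leqnSn _); apply: leq_trans; apply: leq_mul; first by lia.
  by rewrite -(expnD K0 1 1) leq_exp2r //; apply: leq_trans K0f _; apply: gmono.
pose sel (i : 'I_2) := if i == ord0 then c1 else c2.
exists (induced [set x | part x \in [seq sel i | i : 'I_2]]); split; first exact: partP.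
have memT (c : 'I_K0) x : (c == c1) || (c == c2) -> part x = c -> x \in [set x | part x \in [seq sel i | i : 'I_2]].
  move=> cc pc; rewrite inE pc; case/orP: cc => /eqP->.
    by apply/mapP; exists ord0; rewrite ?mem_enum.
  by apply/mapP; exists ord_max; rewrite ?mem_enum.
(* The pigeonhole injection need not be monotone; its image is sorted here, and [r] below
   re-enumerates it increasingly. *)
pose L := [seq val i | i <- enum [set s i | i : 'I_n]].
have sortedL : sorted ltn L.
  have -> : L = [seq x <- iota 0 N | x \in L].
    rewrite -val_enum_ord filter_map; congr map; rewrite {1}/enum_mem -enumT; apply: eq_filter => i /=.
    by rewrite mem_map ?mem_enum //; exact: val_inj.
  by apply: (sorted_filter ltn_trans); exact: iota_ltn_sorted.
have szL : size L = n by rewrite size_map -cardE card_imset // card_ord.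
have Lmem (i : 'I_n) : exists j, nth 0 L i = s j.
  have /mapP[x] : nth 0 L i \in L by rewrite mem_nth ?szL.
  by rewrite mem_enum => /imsetP[j _ ->] ->; exists j.
have /choice[r rP] := Lmem.
have srle (i j : 'I_n) : (s (r i) <= s (r j)) = (i <= j).
  rewrite -!rP; apply/idP/idP; last first.
    rewrite leq_eqVlt => /predU1P[->//|ij]; apply: ltnW.
    by apply: (sorted_ltn_nth ltn_trans) => //; rewrite inE szL.
  apply: contraTT; rewrite -!ltnNge => ij.
  by apply: (sorted_ltn_nth ltn_trans) => //; rewrite inE szL.
have p1 i : u0 (s i) \in [set x | part x \in [seq sel i | i : 'I_2]].
  by apply: (memT c1); rewrite ?eqxx //; have [] := sc i.
have p2 i : v0 (s i) \in [set x | part x \in [seq sel i | i : 'I_2]].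
  by apply: (memT c2); rewrite ?eqxx ?orbT //; have [] := sc i.
exists (fun i _ => to_induced (p1 (r i))), (fun j _ => to_induced (p2 (r j))) => i j /=.
rewrite /join_env (_ : split (lshift _ _) = inl ord0); last exact: (unsplitK (inl _)).
rewrite (_ : split (rshift _ _) = inr ord0); last exact: (unsplitK (inr _)).
by rewrite -srle -uv.
Qed.

(** * Half-graph-free adjacency *)

(** If the constants differed, taking [u] at even and [v] at odd indices would avoid the
    uncontrolled diagonal and give a half graph, with the order of the indices reversed in one of
    the two cases. *)
Lemma no_half_graph_sym (G : graph) h (u v : nat -> gV G) al be : ~ half_graph h G ->
  (forall a b, a < b < h.*2.+1 -> gE (u a) (v b) = al) ->
  (forall a b, b < a < h.*2.+1 -> gE (u a) (v b) = be) -> al = be.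
Proof.
move=> nh H1 H2; case: al be H1 H2 => [] [] // H1 H2; case: nh.
  exists (fun i => u i.*2), (fun j => v j.*2.+1) => i j; have := (ltn_ord i, ltn_ord j).
  move=> [ih jh]; case: (leqP i j) => ij; [apply: H1|apply: H2]; lia.
exists (fun i => u (h - i).*2), (fun j => v ((h - j).*2.-1)) => i j.
have [ih jh] := (ltn_ord i, ltn_ord j).
case: (leqP i j) => ij; [apply: H2|apply: H1]; lia.
Qed.

(** Repeated halving: a vertex separating two rows has one adjacency value shared by at least
    [2 ^ L] rows. Recurse on these, and pair the vertex with a row of the other value. *)
Lemma distinct_rows_split (G : graph) (B : {set gV G}) L (Z : seq (gV G)) :
  uniq Z -> {in Z &, forall z z', z != z' -> exists2 y, y \in B & gE z y != gE z' y} ->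
  2 ^ L <= size Z ->
  exists ps : seq (gV G * gV G), [/\ size ps = L, all (fun p => (p.1 \in Z) && (p.2 \in B)) ps &
    pairwise (fun p q => gE p.1 p.2 != gE q.1 p.2) ps].
Proof.
elim: L Z => [|L IH] Z uZ dist sZ; first by exists [::].
have L0 : 0 < 2 ^ L by rewrite expn_gt0.
have [z [z' [zZ z'Z zz']]] : exists z z', [/\ z \in Z, z' \in Z & z != z'].
  case: Z uZ dist sZ => [|z [|z' Z]] /= uZ _ sZ; rewrite ?expnS in sZ; try lia.
  exists z, z'; rewrite !inE !eqxx orbT; split=> //.
  by move: uZ; rewrite !inE => /andP[/norP[]].
have [y yB zy] := dist z z' zZ z'Z zz'.
pose e := 2 ^ L <= count (fun x => gE x y) Z.
pose Z' := [seq x <- Z | gE x y == e].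
have sZ' : 2 ^ L <= size Z'.
  rewrite size_filter; case E: e.
    by rewrite (eq_count (a2 := fun x => gE x y)) // => x /=; case: gE.
  rewrite (eq_count (a2 := predC (fun x => gE x y))); last by move=> x /=; case: gE.
  move/negbT: E; rewrite -ltnNge.
  have := count_predC (fun x => gE x y) Z; rewrite /predC /=; rewrite expnS in sZ; lia.
have [r rZ re] : exists2 r, r \in Z & gE r y != e.
  case: (eqVneq (gE z y) e) => [ez|]; last by exists z.
  by exists z' => //; rewrite -ez eq_sym.
have subZ' : {subset Z' <= Z} by move=> x; rewrite mem_filter => /andP[].
have [x x' xZ x'Z|ps [sps /allP aps pps]] := IH Z' (filter_uniq _ uZ) _ sZ'.
  by apply: dist; apply: subZ'.
exists ((r, y) :: ps); split; rewrite /= ?sps ?rZ ?yB //.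
  by apply/allP => p /aps /andP[/subZ' -> ->].
rewrite pps andbT; apply/allP => p /aps /andP[+ _].
by rewrite mem_filter => /andP[/eqP ->].
Qed.

(** Ramsey makes the adjacency of row [a] to the vertices attached to column [b] constant on either
    side of the diagonal, and the absence of half graphs equates the two constants. Hence only the
    diagonal can separate rows. The map [ch] will list a path inside a ball; [v0] is an extra column
    whose attached vertices separate no [r b] from [z0]. *)
Lemma distinct_rows_matching (K : finType) n h : exists t, forall (G : graph),
  ~ half_graph h G -> forall (B : {set gV G}) (Z : seq (gV G)) (ch : gV G -> K -> gV G),
  uniq Z -> {in Z &, forall z z', z != z' -> exists2 y, y \in B & gE z y != gE z' y} ->
  t <= size Z ->
  exists (z0 v0 : gV G) (r v : 'I_n -> gV G),
    [/\ z0 \in Z /\ v0 \in B, forall c, r c \in Z /\ v c \in B,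
      forall c, gE (r c) (v c) != gE z0 (v c),
      forall b c l, b != c -> gE (r b) (ch (v c) l) = gE z0 (ch (v c) l) &
      forall b l, gE (r b) (ch v0 l) = gE z0 (ch v0 l)].
Proof.
pose m := maxn n.+2 h.*2.+1.
have [N NP] := ramsey 2 {ffun K -> bool * bool} m.
exists (2 ^ N) => G nh B Z ch uZ dist sZ.
have [ps [sps /allP aps pps]] := distinct_rows_split uZ dist sZ.
have m2 : 1 < m by rewrite /m leq_max.
have [x0 _] : exists x0 : gV G, True.
  have : 0 < size Z by apply: leq_trans sZ; rewrite expn_gt0.
  by case: Z {uZ dist sZ aps} => // x; exists x.
pose nz := nth (x0, x0) ps.
pose col (r : seq nat) : {ffun K -> bool * bool} := let a := nth 0 r 0 in let b := nth 0 r 1 in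
  [ffun l => (gE (nz a).1 (ch (nz b).2 l), gE (nz b).1 (ch (nz a).2 l))].
have [||s [g [sub ss H]]] := NP col (iota 0 N); rewrite ?size_iota ?iota_ltn_sorted //.
have sorts : sorted ltn s := subseq_sorted ltn_trans sub (iota_ltn_sorted _ _).
pose p a := nz (nth 0 s a).
have pmem a : a < m -> (p a).1 \in Z /\ (p a).2 \in B.
  move=> am; have : nth 0 s a \in iota 0 N by apply: (mem_subseq sub); rewrite mem_nth ?ss.
  by rewrite mem_iota => /= lt; have /aps/andP[] : p a \in ps by rewrite mem_nth // sps; lia.
have nlt a b : a < b -> b < m -> nth 0 s a < nth 0 s b.
  by move=> ab bm; apply: (sorted_ltn_nth ltn_trans) => //; rewrite inE ss //; apply: ltn_trans bm.
have pcol a b l : a < b -> b < m ->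
    gE (p a).1 (ch (p b).2 l) = (g l).1 /\ gE (p b).1 (ch (p a).2 l) = (g l).2.
  move=> ab bm; have := H [:: nth 0 s a; nth 0 s b]; rewrite /= nlt // => /(_ isT) H'.
  have /H' : {subset [:: nth 0 s a; nth 0 s b] <= s}.
    by move=> x; rewrite !inE => /orP[]/eqP->; rewrite mem_nth ?ss //; apply: ltn_trans bm.
  by move=> /(_ erefl) /ffunP /(_ l); rewrite ffunE /= => <-.
have gsym l : (g l).1 = (g l).2.
  apply: (no_half_graph_sym (u := fun a => (p a).1) (v := fun b => ch (p b).2 l) nh).
    by move=> a b /andP[ab bh]; have [] := pcol a b l ab (leq_trans bh (leq_maxr _ _)).
  by move=> a b /andP[ba ah]; have [] := pcol b a l ba (leq_trans ah (leq_maxr _ _)).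
have pne a b l : a != b -> a < m -> b < m -> gE (p a).1 (ch (p b).2 l) = (g l).1.
  rewrite neq_ltn => /orP[ab|ba] am bm; first by have [] := pcol a b l ab bm.
  by rewrite gsym; have [] := pcol b a l ba am.
have nm : n.+1 < m by rewrite /m leq_max leqnn.
have im (i : 'I_n) : i.+1 < m by have := ltn_ord i; lia.
(* The last pair provides the reference row, as every earlier column separates its own row from it;
   the first pair provides [v0], and the [n] pairs between them the matching. *)
exists (p n.+1).1, (p 0).2, (fun i => (p i.+1).1), (fun i => (p i.+1).2); split.
- by split; [have [] := pmem n.+1 nm|have [] := pmem 0 (ltnW m2)].
- by move=> c; split; have [] := pmem c.+1 (im c).
- move=> c; have cn : c.+1 < n.+1 by rewrite ltnS.
  have sin a : a < m -> nth 0 s a \in gtn (size ps).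
    move=> am; have : nth 0 s a \in iota 0 N by apply: (mem_subseq sub); rewrite mem_nth ?ss.
    by rewrite mem_iota inE sps.
  exact: (elimT (pairwiseP (x0, x0)) pps _ _ (sin _ (im c)) (sin _ nm) (nlt _ _ cn nm)).
- move=> b c l bc; have cn := ltn_ord c.
  by rewrite (pne _ _ _ _ (im b) (im c)) ?(pne _ _ _ _ nm (im c)) //; lia.
- by move=> b l; rewrite !pne ?im //; apply: ltnW.
Qed.

Lemma count_split (A : eqType) (p : pred A) (s : seq A) L : L <= count p s ->
  exists s1 s2, s = s1 ++ s2 /\ count p s1 = L.
Proof.
elim: s L => [|x s IH] L /=; first by rewrite leqn0 => /eqP->; exists [::], [::].
case: L => [|L]; first by exists [::], (x :: s).
move=> le; have [|s1 [s2 [-> c]]] := IH (L.+1 - p x); first by lia.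
by exists (x :: s1), s2; rewrite /= c; case: (p x); split=> //; lia.
Qed.

(** Cut [s] after [L] true values. Either [L] false values follow the cut, or at least [L] precede
    it and [L] true values follow. *)
Lemma two_blocks (A : eqType) (f : A -> bool) (s : seq A) L :
  L.*2 <= count f s -> L.*2 <= count (predC f) s ->
  exists r (b : bool), subseq r s /\ map f r = nseq L b ++ nseq L (~~ b).
Proof.
move=> cf cf'.
have [|s1 [s2 [sE cs1]]] := @count_split _ f s L; first by lia.
have blk (b : bool) (t : seq A) : L <= count (fun x => f x == b) t ->
    exists2 r, subseq r t & map f r = nseq L b.
  move=> ct; exists (take L (filter (fun x => f x == b) t)).
    by apply: subseq_trans (take_subseq _ _) (filter_subseq _ _).
  set r := take L _.
  have sr : size r = L by rewrite size_takel // size_filter.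
  have /all_pred1P -> : all (pred1 b) (map f r); last by rewrite size_map sr.
  by apply/allP => _ /mapP[x /mem_take + ->]; rewrite mem_filter => /andP[].
have cT t : count (fun x => f x == true) t = count f t by apply: eq_count => x; case: (f x).
have cF t : count (fun x => f x == false) t = count (predC f) t.
  by apply: eq_count => x /=; case: (f x).
have cat2 b : L <= count (fun x => f x == b) s1 -> L <= count (fun x => f x == ~~ b) s2 ->
    exists r (b : bool), subseq r s /\ map f r = nseq L b ++ nseq L (~~ b).
  move=> /blk[r1 sub1 e1] /blk[r2 sub2 e2]; exists (r1 ++ r2), b.
  by rewrite map_cat e1 e2 sE cat_subseq.
have scount (p : pred A) : count p s = count p s1 + count p s2 by rewrite sE count_cat.
case: (leqP L (count (predC f) s2)) => H; first by apply: (cat2 true); rewrite /= ?cT ?cF ?cs1.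
have [e1 e2] := (scount f, scount (predC f)).
by apply: (cat2 false); rewrite /= ?cT ?cF; lia.
Qed.

Lemma nth_take_drop (A : Type) (x0 : A) (s : seq A) a n i :
  i < n -> nth x0 (take n (drop a s)) i = nth x0 s (a + i).
Proof. by move=> ilt; rewrite nth_take // nth_drop. Qed.

(* In a homogeneous index sequence a mixed trace would occur on every window, and shifting
   the window would produce a half graph. *)
Lemma trace_small_or_cosmall (P : finType) h n : exists N, forall (G : graph),
  ~ half_graph h G -> forall (y : P -> nat -> gV G) (s : seq nat),
  sorted ltn s -> N <= size s -> exists s', [/\ subseq s' s, size s' = n &
    forall p z, count (fun i => gE z (y p i)) s' < h.*2.+1.*2 \/
                count (predC (fun i => gE z (y p i))) s' < h.*2.+1.*2].
Proof.
set L := h.*2.+1; pose m := maxn n (L + L.*2).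
have [N NP] := ramsey L.*2 {set P * (L.*2).-tuple bool} m.
exists N => G nh y s ss Ns.
pose col (r : seq nat) := [set q : P * (L.*2).-tuple bool |
  [exists z, map (fun i => gE z (y q.1 i)) r == q.2]].
have [s1 [C [sub sz H]]] := NP col s ss Ns.
have ss1 : sorted ltn s1 := subseq_sorted ltn_trans sub ss.
suff small p z : count (fun i => gE z (y p i)) s1 < L.*2 \/
                count (predC (fun i => gE z (y p i))) s1 < L.*2.
  exists (take n s1); split; first exact: (subseq_trans (take_subseq _ _) sub).
    by rewrite size_takel // sz leq_maxl.
  move=> p z; case: (small p z) => H1; [left|right]; apply: leq_ltn_trans H1;
    exact: (leq_count_subseq _ (take_subseq _ _)).
case: (leqP L.*2 (count (fun i => gE z (y p i)) s1)) => c1; last by left.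
case: (leqP L.*2 (count (predC (fun i => gE z (y p i))) s1)) => c2; last by right.
have [r [b [rs1 rb]]] := two_blocks c1 c2; exfalso.
have sr : size r = L.*2 by rewrite -(size_map (fun i => gE z (y p i))) rb size_cat !size_nseq addnn.
have pat : size (nseq L b ++ nseq L (~~ b)) == L.*2 by rewrite size_cat !size_nseq addnn.
have Cp : (p, Tuple pat) \in C.
  rewrite -(H r _ (mem_subseq rs1) sr); last exact: (subseq_sorted ltn_trans rs1 ss1).
  by rewrite inE; apply/existsP; exists z; rewrite /= rb.
(* All windows of length [L.*2] realize the same traces by homogeneity, so each of the [L] shifted
   windows realizes the mixed one. *)
have win c : c < L -> exists z, map (fun i => gE z (y p i)) (take L.*2 (drop c s1)) =
    nseq L b ++ nseq L (~~ b).
  move=> cL; set w := take _ _.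
  have subw : subseq w s1 by apply: subseq_trans (take_subseq _ _) (drop_subseq _ _).
  have sw : size w = L.*2.
    by rewrite size_takel // size_drop sz; have := leq_maxr n (L + L.*2); rewrite -/m; lia.
  have := H w (subseq_sorted ltn_trans subw ss1) (mem_subseq subw) sw.
  by move=> E; rewrite -E inE in Cp; have /existsP[z' /eqP ez] := Cp; exists z'.
have /choice[f fP] : forall c, exists z, c < L -> map (fun i => gE z (y p i)) (take L.*2 (drop c s1)) =
    nseq L b ++ nseq L (~~ b).
  by move=> c; case: (ltnP c L) => [/win[z' ?]|_]; [exists z'|exists z].
(* The trace found for shift [c] switches at position [L + c]; on the fixed block of positions
   [L + j] its value tells whether [j < c]. *)
have fE c j : c < L -> j < L -> gE (f c) (y p (nth 0 s1 (L + j))) = if j < c then b else ~~ b.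
  move=> cL jL; have /(congr1 (fun t => nth false t (L + j - c))) := fP c cL.
  have szw : L.*2 <= size (drop c s1).
    by rewrite size_drop sz; have := leq_maxr n (L + L.*2); rewrite -/m; lia.
  rewrite (nth_map 0); last by rewrite size_takel //; lia.
  rewrite nth_take_drop; last by lia.
  rewrite (_ : c + (L + j - c) = L + j); last by lia.
  move=> ->; rewrite nth_cat size_nseq !nth_nseq.
  have -> : (L + j - c < L) = (j < c) by lia.
  by case: ifP => // jc; rewrite ifT //; lia.
have := @no_half_graph_sym G h f (fun j => y p (nth 0 s1 (L + j))) (~~ b) b nh.
have F a c : a < c < L -> gE (f a) (y p (nth 0 s1 (L + c))) = ~~ b.
  by move=> /andP[ac cL]; rewrite fE ?(ltn_trans ac) // ltnNge (ltnW ac).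
have F' a c : c < a < L -> gE (f a) (y p (nth 0 s1 (L + c))) = b.
  by move=> /andP[ca aL]; rewrite fE ?(ltn_trans ca aL) ?ca.
by move=> /(_ F F'); case: (b).
Qed.

(** * Samples *)

Definition ball (J W : finType) (G : graph) (w : W -> gV G) (s : J -> gV G) Fs : {set gV G} :=
  [set z | reach setT w s Fs z].

Lemma reach_chain_fun (J W : finType) (G : graph) (w : W -> gV G) (s : J -> gV G) Fs :
  exists ch : gV G -> 'I_(size Fs).+1 -> gV G, forall z, z \in ball w s Fs ->
  [/\ exists l, ch z l = z, forall l, ch z l \in ball w s Fs &
      forall X : {set gV G}, (forall l, ch z l \in X) -> reach X w s Fs z].
Proof.
suff /choice[ch chP] : forall z, exists c : 'I_(size Fs).+1 -> gV G, z \in ball w s Fs ->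
    [/\ exists l, c l = z, forall l, c l \in ball w s Fs &
      forall X : {set gV G}, (forall l, c l \in X) -> reach X w s Fs z] by exists ch.
move=> z; case: (boolP (z \in _)) => [|_]; last by exists (fun _ => z).
rewrite inE => /reach_chain[c [sc zc cr cX]]; exists (fun l => nth z c l) => _; split.
- have lt : index z c < (size Fs).+1 by rewrite -sc index_mem.
  by exists (Ordinal lt); rewrite nth_index.
- by move=> l; rewrite inE cr // mem_nth // sc.
- move=> X HX; apply: cX => v /(nthP z)[i]; rewrite sc => lt <-; exact: (HX (Ordinal lt)).
Qed.

Definition diff (G : graph) (B : {set gV G}) (z z' : gV G) : bool :=
  [exists y in B, gE z y != gE z' y].

Lemma diff_sym (G : graph) (B : {set gV G}) z z' : diff B z z' = diff B z' z.
Proof. by apply: eq_existsb => y; rewrite (eq_sym (gE z y)). Qed.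

Definition disjoint_on (G : graph) (B : nat -> {set gV G}) (idx : seq nat) :=
  forall i j x, i \in idx -> j \in idx -> x \in B i -> x \in B j -> i = j.

Definition pairwise_diff (G : graph) (B : nat -> {set gV G}) (Z : seq (gV G)) (idx : seq nat) :=
  forall z z' i, z \in Z -> z' \in Z -> z != z' -> i \in idx -> diff (B i) z z'.

Lemma sorted_ltn_uniq (s : seq nat) : sorted ltn s -> uniq s.
Proof. exact: (sorted_uniq ltn_trans ltnn). Qed.

Lemma count_disjoint (G : graph) (B : nat -> {set gV G}) idx x :
  uniq idx -> disjoint_on B idx -> count (fun i => x \in B i) idx <= 1.
Proof.
elim: idx => //= i idx IH /andP[iidx uidx] dis.
have dis' : disjoint_on B idx by move=> a b y ai bi; apply: dis; rewrite inE ?ai ?bi orbT.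
case: (boolP (x \in B i)) => [xi|_]; last by rewrite add0n IH.
suff -> : count (fun i => x \in B i) idx = 0 by [].
apply/eqP; rewrite -leqn0 leqNgt -has_count; apply/hasPn => j jidx; apply/negP => xj.
have E : i = j by apply: (dis _ _ x) => //; rewrite inE ?eqxx ?jidx ?orbT.
by move: iidx; rewrite E jidx.
Qed.

(** In the configuration built below, the row consists of the centres [W], and the column of the two
    compared vertices together with the parameters. *)
Definition row_pred (J W : finType) (Fs : seq (link J)) : gpred (W + (bool + J)) :=
  fun G X e => exists2 v, v \in X &
    reach X (e \o inl) (e \o inr \o inr) Fs v /\ gE (e (inr (inl true))) v != gE (e (inr (inl false))) v.

Lemma definable_row_pred (J W : finType) (Fs : seq (link J)) : definable (row_pred (W := W) Fs).
Proof.
apply: (@definable_ex _ (fun G X (e : option (W + (bool + J)) -> gV G) =>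
  reach X (e \o (Some \o inl)) (e \o (Some \o inr \o inr)) Fs (e None) /\
  gE (e (Some (inr (inl true)))) (e None) != gE (e (Some (inr (inl false)))) (e None))).
apply: definable_and; first exact: definable_reach.
set i := Some _; set j := Some (inr (inl false)).
have := definable_or (definable_and (definable_edge i None) (definable_not (definable_edge j None)))
  (definable_and (definable_not (definable_edge i None)) (definable_edge j None)).
apply: definable_ext => G X e; case: (gE (e i) _); case: (gE (e j) _).
- by split=> [[[_ /(_ isT)]|[/(_ isT)]]|].
- by split=> // _; left.
- by split=> // _; right.
- by split=> [[[]|[]]|].
Qed.

(** Each ball contains a matching with rows of [Z], and pigeonhole selects [n] balls using the same
    rows. The path to a matched vertex is the witness of a cell: without it, the vertices of [X]
    left in the ball do not separate [r c] from [z0]. *)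
Lemma distinct_rows_config (J W : finType) k h n : exists t M, forall (G : graph),
  ~ half_graph h G -> forall (s : J -> gV G) (w : nat -> W -> gV G) (Fs : seq (link J)) idx Z,
  size Fs = k -> sorted ltn idx -> disjoint_on (fun i => ball (w i) s Fs) idx ->
  uniq Z -> size Z = t -> M <= size idx -> pairwise_diff (fun i => ball (w i) s Fs) Z idx ->
  config 'I_k.+1 (row_pred (W := W) Fs) n G.
Proof.
have [t tP] := distinct_rows_matching ('I_k.+1 + W)%type n h.
pose T : finType := ('I_t * {ffun 'I_n -> 'I_t})%type.
exists t, (n * #|T| + (t + #|J|) + 1) => G nh s w Fs idx Z sF; subst k.
move=> sidx dis uZ sZ big pd.
pose B i := ball (w i) s Fs.
pose L := Z ++ [seq s j | j <- enum J].
(* Balls meeting [Z] or the parameters are dropped, so no column vertex lies in a remaining ball; by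
   disjointness few are lost. *)
pose idx' := [seq i <- idx | ~~ has (fun x => x \in B i) L].
have sL : size L = t + #|J| by rewrite size_cat sZ size_map -cardE.
have sidx' : n * #|T| < size idx'.
  have := count_negb (fun i => has (fun x => x \in B i) L) idx.
  have : count (fun i => has (fun x => x \in B i) L) idx <= size L * 1.
    by apply: count_has_le => x _; apply: count_disjoint => //; exact: sorted_ltn_uniq.
  by rewrite size_filter sL; lia.
have idx'P i : i \in idx' -> i \in idx /\ {in L, forall x, x \notin B i}.
  by rewrite mem_filter => /andP[/hasPn H ->].
have /choice[ch chP] := fun i => reach_chain_fun (w i) s Fs.
(* The centres are appended to each path, so that agreement on the vertices attached to [v0] covers
   the centres too. *)
pose chw i v (l : 'I_(size Fs).+1 + W) := match l with inl l => ch i v l | inr a => w i a end.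
have main i : i \in idx' -> exists d : (gV G * gV G) * (('I_n -> gV G) * ('I_n -> gV G)),
    [/\ d.1.1 \in Z /\ d.1.2 \in B i, forall c, d.2.1 c \in Z /\ d.2.2 c \in B i,
      forall c, gE (d.2.1 c) (d.2.2 c) != gE d.1.1 (d.2.2 c),
      forall b c l, b != c -> gE (d.2.1 b) (chw i (d.2.2 c) l) = gE d.1.1 (chw i (d.2.2 c) l) &
      forall b l, gE (d.2.1 b) (chw i d.1.2 l) = gE d.1.1 (chw i d.1.2 l)].
  move=> /idx'P[iidx _].
  have [|||z0 [v0 [r [v H]]]] := tP G nh (B i) Z (chw i).
  - by [].
  - by move=> z z' zZ z'Z zz'; have /exists_inP := pd z z' i zZ z'Z zz' iidx.
  - by rewrite sZ.
  by exists ((z0, v0), (r, v)).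
have i0 : nth 0 idx' 0 \in idx' by rewrite mem_nth //; apply: leq_ltn_trans sidx'.
have [d0 [[d0Z _] _ _ _ _]] := main _ i0.
have tpos : 0 < t by rewrite -sZ; case: (Z) d0Z.
have idxq (q : 'I_(n * #|T|)) : nth 0 idx' q \in idx'.
  by rewrite mem_nth // (ltn_trans _ sidx').
have /choice[d dP] := fun q => main _ (idxq q).
(* The remainder only serves to obtain an ordinal; it leaves the index of an element of [Z]
   unchanged. *)
have ix z : index z Z %% t < t by rewrite ltn_mod.
pose col q : T := (Ordinal (ix (d q).1.1), [ffun c => Ordinal (ix ((d q).2.1 c))]).
have [|tau [g g_inj gtau]] := pigeonhole_count col (Ordinal tpos, [ffun=> Ordinal tpos]) (t := n).
  by rewrite card_ord.
pose x0 := d0.1.1.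
have nix z : z \in Z -> nth x0 Z (index z Z %% t) = z.
  by move=> zZ; rewrite modn_small -?sZ ?index_mem // nth_index.
pose z0 := nth x0 Z tau.1; pose r c := nth x0 Z (tau.2 c).
have z0E q : (d (g q)).1.1 = z0.
  by have [[zZ _] _ _ _ _] := dP (g q); rewrite /z0 -(gtau q) /= nix.
have rE q c : (d (g q)).2.1 c = r c.
  by have [_ /(_ c)[zZ _] _ _ _] := dP (g q); rewrite /r -(gtau q) /= ffunE /= nix.
have uidx' : uniq idx' by rewrite filter_uniq // sorted_ltn_uniq.
pose iq q := nth 0 idx' (g q); pose v q := (d (g q)).2.2.
have iq_inj : injective iq.
  move=> q q' /eqP; rewrite nth_uniq //; last 2 first.
  - exact: ltn_trans (ltn_ord _) sidx'.
  - exact: ltn_trans (ltn_ord _) sidx'.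
  by move=> /eqP/val_inj/g_inj.
have same q q' x : x \in B (iq q) -> x \in B (iq q') -> q' = q.
  move=> xq xq'; apply: iq_inj; apply/esym; apply: (dis _ _ x) => //.
    by have [] := idx'P _ (idxq (g q)).
  by have [] := idx'P _ (idxq (g q')).
exists (fun q => w (iq q)), (fun c => sumf (fun b : bool => if b then r c else z0) s),
  (fun q c => ch (iq q) (v q c)) => q c X.
have [_ vP vne vch v0ch] := dP (g q).
have [_ v0B] : (d (g q)).1.1 \in Z /\ (d (g q)).1.2 \in B (iq q) by have [] := dP (g q).
have [_ vB] := vP c.
have [chv chB chX] := chP (iq q) (v q c) vB.
split.
  move=> Xw Xs Xp; exists (v q c).
    by have [l <-] := chv; exact: Xp.
  split; first exact: chX.
  by have := vne c; rewrite rE z0E.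
move=> HX [x xX [rx]]; apply/negP; rewrite negbK /=; apply/eqP.
have xB : x \in B (iq q) by rewrite inE; apply: reach_mono rx; exact: subsetT.
have wB q' a : w (iq q') a \in B (iq q').
  rewrite inE /=; elim: (Fs) => [|F Fs' IH] /=; last by rewrite IH.
  by apply/existsP; exists a.
(* A centre belongs to ball [q] itself and separates nothing, by [v0]; column vertices avoid the
   ball; a foreign witness in the ball has the same [q] and another [c'], where the matching gives
   agreement. *)
have [[q' [a xE]]|[c' [[b|j] xE]]|[q' [c' [l [ne xE]]]]] := HX x xX.
- have qq : q' = q by apply: (same _ _ x) => //; rewrite xE wB.
  by have := v0ch c (inr a); rewrite rE z0E xE qq.
- have xL : x \in L.
    rewrite mem_cat xE /=; apply/orP; left; case: (b).
      by rewrite -(rE q); have [] := vP c'.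
    by rewrite -(z0E q); have [[]] := dP (g q).
  by have [_ /(_ x xL)] := idx'P _ (idxq (g q)); rewrite xB.
- have xL : x \in L by rewrite mem_cat xE /= map_f ?orbT // mem_enum.
  by have [_ /(_ x xL)] := idx'P _ (idxq (g q)); rewrite xB.
- have [_ vP' _ _ _] := dP (g q').
  have [_ vB'] := vP' c'.
  have [_ chB' _] := chP (iq q') (v q' c') vB'.
  have qq : q' = q by apply: (same _ _ x) => //; rewrite xE.
  subst q'; have cc : c != c' by apply/eqP => E; apply: ne; rewrite E.
  by have := vch c c' (inl l) cc; rewrite rE z0E xE.
Qed.

(** While some vertex differs from all of [Z] on more than [M] balls, add it and keep only those
    balls. Size [t] is excluded, so this stops. The threshold [m] depends on the stopping stage,
    hence the required length is a function [Phi] of it. *)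
Lemma fresh_bounded t MX (Phi : nat -> nat) u : exists M, forall (G : graph) (B : nat -> {set gV G}) Z (idx : seq nat),
  (forall Z' (idx' : seq nat), uniq Z' -> size Z' = t -> subseq idx' idx -> MX <= size idx' ->
     ~ pairwise_diff B Z' idx') ->
  uniq Z -> size Z + u = t -> pairwise_diff B Z idx -> M <= size idx ->
  exists Z' m (idx' : seq nat), [/\ uniq Z', size Z' < t, subseq idx' idx, Phi m <= size idx' & 
    pairwise_diff B Z' idx' /\ forall z, count (fun i => all (diff (B i) z) Z') idx' < m].
Proof.
elim: u => [|u [M IH]].
  exists MX => G B Z idx no uZ; rewrite addn0 => sZ pd Mi.
  by case: (no Z idx uZ sZ (subseq_refl _) Mi pd).
exists (Phi M.+1) => G B Z idx no uZ sZ pd Mi.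
case: (pselect (exists z, M < count (fun i => all (diff (B i) z) Z) idx)) => [[z Mz]|nz]; last first.
  exists Z, M.+1, idx; split=> //; first by lia.
  by split=> // z; rewrite ltnNge; apply/negP => H; apply: nz; exists z.
pose idx1 := [seq i <- idx | all (diff (B i) z) Z].
have sub1 : subseq idx1 idx := filter_subseq _ _.
have s1 : M < size idx1 by rewrite size_filter.
have f1 i z' : i \in idx1 -> z' \in Z -> diff (B i) z z'.
  by rewrite mem_filter => /andP[/allP H _]; exact: H.
have zZ : z \notin Z.
  apply/negP => zZ; case: (idx1) s1 f1 => // i idx2 _ /(_ i z (mem_head _ _) zZ).
  by move=> /exists_inP[y _]; rewrite eqxx.
have [|||||Z' [m [idx' [H1 H2 H3 H4 H5]]]] := IH G B (z :: Z) idx1.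
- by move=> Z' idx' uZ' sZ' sub'; apply: no => //; exact: subseq_trans sub1.
- by rewrite /= zZ.
- by rewrite /= addSn -addnS.
- move=> y y' i; rewrite !inE => /predU1P[->|yZ] /predU1P[->|y'Z] ne i1.
  + by rewrite eqxx in ne.
  + exact: f1.
  + by rewrite diff_sym; exact: f1.
  + by apply: pd => //; exact: (mem_subseq sub1).
- exact: ltnW.
by exists Z', m, idx'; split=> //; exact: subseq_trans sub1.
Qed.

(** Once the family [Z] cannot grow, each [z] agrees with some member of [Z] on almost every ball.
    Agreeing often with two members would give [z] a mixed trace on the vertices separating them, so
    a single member serves on all but [d] balls. *)
Lemma sample_set t MX h (Psi : nat -> nat) : exists M, forall (G : graph),
  ~ half_graph h G -> forall (B : nat -> {set gV G}) (idx : seq nat), gV G ->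
  (forall Z' (idx' : seq nat), uniq Z' -> size Z' = t -> subseq idx' idx -> MX <= size idx' ->
     ~ pairwise_diff B Z' idx') ->
  sorted ltn idx -> M <= size idx ->
  exists Z d (idx' : seq nat), [/\ uniq Z, size Z <= t, subseq idx' idx, Psi d <= size idx' &
    pairwise_diff B Z idx' /\ forall z, exists2 z', z' \in Z & count (fun i => diff (B i) z z') idx' <= d].
Proof.
pose P : finType := ('I_t * 'I_t)%type; pose L := h.*2.+1.*2.
have /choice[N2 N2P] := fun n => trace_small_or_cosmall P h n.
have /choice[N1 N1P] := fun n => ramsey 1 {ffun P -> bool} n.
(* Fewer than [m] balls distinguish [z] from all members, and each of at most [t] members other than
   the chosen one agrees with [z] on at most [L] balls. *)
pose d m := m + t * L.
have [M MP] := fresh_bounded t MX (fun m => N1 (N2 (maxn (Psi (d m)) (d m).+1))) t.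
exists M => G nh B idx x0 no sidx Midx.
have [|Z [m [idx1 [uZ sZ sub1 Phi1 [pd fr]]]]] := MP G B [::] idx no isT (erefl t) _ Midx; first by [].
have sidx1 := subseq_sorted ltn_trans sub1 sidx.
pose nz (a : 'I_t) := nth x0 Z a.
have /choice[y yP] : forall q : P * nat, exists v : gV G,
    nz q.1.1 != nz q.1.2 -> nz q.1.1 \in Z -> nz q.1.2 \in Z -> q.2 \in idx1 ->
    v \in B q.2 /\ gE (nz q.1.1) v != gE (nz q.1.2) v.
  move=> [[a b] i] /=; case: (pselect (diff (B i) (nz a) (nz b))) => [/exists_inP[v vB ne]|nd].
    by exists v.
  by exists x0 => ne aZ bZ i1; case: nd; apply: pd.
(* Ramsey for singletons: the adjacency of [nz p.1] to its separator from [nz p.2] becomes the same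
   on all retained balls. *)
pose col (r : seq nat) : {ffun P -> bool} := [ffun p => gE (nz p.1) (y (p, nth 0 r 0))].
have [idx2 [g [sub2 s2 H2]]] := N1P _ col idx1 sidx1 Phi1.
have sign p i : i \in idx2 -> gE (nz p.1) (y (p, i)) = g p.
  move=> i2; have := H2 [:: i] isT; rewrite /col => /(_ _ erefl) <-; first by rewrite ffunE.
  by move=> j; rewrite inE => /eqP->.
have sidx2 := subseq_sorted ltn_trans sub2 sidx1.
have [idx3 [sub3 s3 H3]] := N2P _ G nh (fun p i => y (p, i)) idx2 sidx2 (eq_leq (esym s2)).
have mem2 := mem_subseq sub3; have mem1 := mem_subseq sub2.
exists Z, (d m), idx3; split=> //.
- exact: ltnW.
- by apply: subseq_trans sub3 _; apply: subseq_trans sub2 sub1.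
- by rewrite s3 leq_maxl.
split; first by move=> z z' i zZ z'Z ne i3; apply: pd => //; apply/mem1/mem2.
move=> z.
have frz : count (fun i => all (diff (B i) z) Z) idx3 < m.
  apply: leq_ltn_trans (fr z); apply: leq_count_subseq; exact: subseq_trans sub3 sub2.
have [z1 z1Z big1] : exists2 z1, z1 \in Z & L <= count (fun i => ~~ diff (B i) z z1) idx3.
  apply: contrapT => nex.
  have : count (fun i => has (fun z1 => ~~ diff (B i) z z1) Z) idx3 <= size Z * L.
    apply: count_has_le => z1 z1Z; rewrite leqNgt; apply/negP => H; apply: nex.
    by exists z1 => //; exact: ltnW.
  have := count_predC (fun i => all (diff (B i) z) Z) idx3.
  rewrite (eq_count (a1 := predC _) (a2 := (fun i => has (fun z1 => ~~ diff (B i) z z1) Z))); last first.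
    by move=> i; rewrite /= -has_predC.
  have := leq_maxr (Psi (d m)) (d m).+1; rewrite -s3 /d.
  have : size Z * L <= t * L by rewrite leq_mul2r (ltnW sZ) orbT.
  have arith (a b c e q : nat) : c < m -> b <= a -> m + a < q -> c + e = q -> e <= b -> False by lia.
  exact: (arith _ _ _ _ _ frz).
exists z1 => //.
have small z2 : z2 \in Z -> z2 != z1 -> count (fun i => ~~ diff (B i) z z2) idx3 <= L.
  move=> z2Z ne; have lt z' : z' \in Z -> index z' Z < t by rewrite -index_mem => /ltn_trans; exact.
  pose a := Ordinal (lt _ z1Z); pose b := Ordinal (lt _ z2Z); pose p : P := (a, b).
  have na : nz a = z1 by rewrite /nz nth_index.
  have nb : nz b = z2 by rewrite /nz nth_index.
  have agree i z' : ~~ diff (B i) z z' -> y (p, i) \in B i -> gE z (y (p, i)) = gE z' (y (p, i)).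
    move=> nd yB; apply/eqP; apply: contraNT nd => H; apply/exists_inP; by exists (y (p, i)).
  have yp i : i \in idx3 -> [/\ y (p, i) \in B i, gE z1 (y (p, i)) = g p & gE z2 (y (p, i)) = ~~ g p].
    move=> i3; have [||||yB] := yP (p, i); rewrite /= ?na ?nb //; first by rewrite eq_sym.
      by apply/mem1/mem2.
    have := sign p i (mem2 _ i3); rewrite /= na => -> /eqP H; split=> //.
    by move: H; case: (g p); case: gE.
  have A1 : L <= count (fun i => gE z (y (p, i)) == g p) idx3.
    apply: leq_trans big1 _; apply: count_sub_in => i i3 nd.
    by have [yB e1 _] := yp i i3; rewrite (agree i z1 nd yB) e1.
  have A2 : count (fun i => ~~ diff (B i) z z2) idx3 <= count (fun i => gE z (y (p, i)) == ~~ g p) idx3.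
    apply: count_sub_in => i i3 nd.
    by have [yB _ e2] := yp i i3; rewrite (agree i z2 nd yB) e2.
  have eT : count (fun i => gE z (y (p, i)) == true) idx3 = count (fun i => gE z (y (p, i))) idx3.
    by apply: eq_count => i; case: gE.
  have eF : count (fun i => gE z (y (p, i)) == false) idx3 = count (predC (fun i => gE z (y (p, i)))) idx3.
    by apply: eq_count => i /=; case: gE.
  apply: leq_trans A2 _; move: A1; have := H3 p z; rewrite -/L; case: (g p) => /=; rewrite ?eT ?eF => -[] H A1;
    by [rewrite ltnNge A1 in H|exact: ltnW].
have sub i : diff (B i) z z1 -> all (diff (B i) z) Z || has (fun z2 => (z2 != z1) && ~~ diff (B i) z z2) Z.
  move=> dz1; case: (boolP (all _ _)) => //= /allPn[z2 z2Z nd]; apply/hasP; exists z2 => //.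
  by rewrite nd andbT; apply: contraNneq nd => ->.
apply: leq_trans (_ : count (predU (fun i => all (diff (B i) z) Z)
    (fun i => has (fun z2 => (z2 != z1) && ~~ diff (B i) z z2) Z)) idx3 <= _).
  by apply: sub_count => i; exact: sub.
have := count_predUI (fun i => all (diff (B i) z) Z)
    (fun i => has (fun z2 => (z2 != z1) && ~~ diff (B i) z z2) Z) idx3.
have : count (fun i => has (fun z2 => (z2 != z1) && ~~ diff (B i) z z2) Z) idx3 <= size Z * L.
  apply: count_has_le => z2 z2Z; case: (eqVneq z2 z1) => [_|ne] /=; first by rewrite count_pred0.
  exact: small.
have ZL : size Z * L <= t * L by rewrite leq_mul2r (ltnW sZ) orbT.
have arith (a b c e q r : nat) : c < m -> b <= a -> e <= b -> q + r = c + e -> q <= m + a by lia.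
exact: (arith _ _ _ _ _ _ frz ZL).
Qed.

Definition lift_link (J J' : finType) (F : link J) : link (J + J')%type :=
  [ffun t : {set J + J'} * {set J + J'} => F ([set j | inl j \in t.1], [set j | inl j \in t.2])].

Lemma reach_lift (J J' W : finType) (G : graph) (X : {set gV G}) (w : W -> gV G)
  (s : J -> gV G) (s' : J' -> gV G) (Fs : seq (link J)) z :
  reach X w (sumf s s') (map (@lift_link J J') Fs) z = reach X w s Fs z.
Proof.
have tpE x : [set j | inl j \in tp (sumf s s') x] = tp s x by apply/setP => j; rewrite !inE.
elim: Fs z => //= F Fs IH z; rewrite IH; congr (_ || _).
by apply: eq_existsb => x; rewrite IH /mis ffunE !tpE.
Qed.

(** Two balls meet inside [X]; the row carries the centres of one, the column those of the other and
    the parameters. *)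
Definition pair_pred (J W : finType) (Fs : seq (link J)) : gpred (W + (W + J)) :=
  fun G X e => exists2 z, z \in X &
    reach X (e \o inl) (e \o inr \o inr) Fs z /\ reach X (e \o inr \o inl) (e \o inr \o inr) Fs z.

Lemma definable_pair_pred (J W : finType) (Fs : seq (link J)) : definable (pair_pred (W := W) Fs).
Proof.
apply: (@definable_ex _ (fun G X (e : option (W + (W + J)) -> gV G) =>
  reach X (e \o (Some \o inl)) (e \o (Some \o inr \o inr)) Fs (e None) /\
  reach X (e \o (Some \o inr \o inl)) (e \o (Some \o inr \o inr)) Fs (e None))).
by apply: definable_and; exact: definable_reach.
Qed.

Lemma count_le2 (p : pred nat) (s : seq nat) i j :
  uniq s -> (forall l, l \in s -> p l -> l = i \/ l = j) -> count p s <= 2.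
Proof.
move=> us H; rewrite -size_filter; apply: (uniq_leq_size (s2 := [:: i; j])); first exact: filter_uniq.
by move=> l; rewrite mem_filter !inE => /andP[pl ls]; have [->|->] := H l ls pl; rewrite eqxx ?orbT.
Qed.

(* Five test indices: two vertices with at most two exceptions each share a non-exceptional
   test, so the type over the tests determines the sample row. *)
Lemma test_link (J : finType) t (G : graph) (B : nat -> {set gV G}) (T0 : seq nat)
  (Z : seq (gV G)) (a : gV G -> gV G) (x0 : gV G) (y : 'I_t * 'I_t -> nat -> gV G) (s : J -> gV G) :
  size Z <= t -> size T0 = 5 -> (forall z, a z \in Z) ->
  (forall (p : 'I_t * 'I_t) i, i \in T0 -> nth x0 Z p.1 \in Z -> nth x0 Z p.2 \in Z -> nth x0 Z p.1 != nth x0 Z p.2 ->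
    y p i \in B i /\ gE (nth x0 Z p.1) (y p i) != gE (nth x0 Z p.2) (y p i)) ->
  let s' (j : 'I_t + 'I_5 * ('I_t * 'I_t)) :=
    match j with inl b => nth x0 Z b | inr q => y q.2 (nth 0 T0 q.1) end in
  exists F : link (J + ('I_t + 'I_5 * ('I_t * 'I_t)))%type,
    forall x z, count (fun i => diff (B i) z (a z)) T0 <= 2 ->
      mis (sumf s s') F x z = (gE z x != gE (a z) x).
Proof.
move=> sZ sT aZ yP s'; pose good z := count (fun i => diff (B i) z (a z)) T0 <= 2.
have lt z : index (a z) Z < t by rewrite (leq_trans _ sZ) // index_mem.
pose ix z := Ordinal (lt z).
have nix z : nth x0 Z (ix z) = a z by rewrite nth_index.
pose tt := tp (sumf s s').
have same z z' : good z -> good z' -> tt z = tt z' -> a z = a z'.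
  move=> gz gz' tE; apply: contrapT => /eqP ne.
  have [i iT] : exists2 i, i \in T0 & ~~ diff (B i) z (a z) && ~~ diff (B i) z' (a z').
    apply: contrapT => nex.
    have := count_predUI (fun i => diff (B i) z (a z)) (fun i => diff (B i) z' (a z')) T0.
    have -> : count (predU (fun i => diff (B i) z (a z)) (fun i => diff (B i) z' (a z'))) T0 = 5.
      rewrite -sT; apply/eqP; rewrite -all_count; apply/allP => i iT /=.
      by apply: contrapT => /negP; rewrite negb_or => H; apply: nex; exists i.
    by move: gz gz'; rewrite /good; lia.
  case/andP=> nz nz'.
  have := yP (ix z, ix z') i iT; rewrite /= !nix => /(_ (aZ z) (aZ z') ne) [yB] /negP; apply.
  have agree u : ~~ diff (B i) u (a u) -> gE u (y (ix z, ix z') i) = gE (a u) (y (ix z, ix z') i).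
    by move=> nd; apply/eqP; apply: contraNT nd => H; apply/exists_inP; exists (y (ix z, ix z') i).
  rewrite -!agree //.
  have iT5 : index i T0 < 5 by rewrite -sT index_mem.
  move/setP: tE => /(_ (inr (inr (Ordinal iT5, (ix z, ix z'))))).
  by rewrite !inE /= nth_index // => ->.
have /choice[sg sgP] : forall T, exists j : 'I_t, forall z, good z -> tt z = T -> nth x0 Z j = a z.
  move=> T; case: (pselect (exists2 z, good z & tt z = T)) => [[z gz zT]|nz]; last first.
    by exists (ix x0) => z gz zT; case: nz; exists z.
  by exists (ix z) => z' gz' z'T; rewrite nix; apply: same => //; rewrite zT.
(* The sample rows are among the parameters, so the type of [x] contains its adjacency to [a z],
   while the type of [z] tells which sample row to read. *)
exists [ffun q : {set J + ('I_t + 'I_5 * ('I_t * 'I_t))} * {set J + ('I_t + 'I_5 * ('I_t * 'I_t))} => inr (inl (sg q.2)) \in q.1] => x z gz.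
rewrite /mis ffunE /= inE /= (sgP _ z gz erefl).
by rewrite gE_sym (gE_sym _ (a z)).
Qed.

(** * Growing the balls *)

Lemma no_config_uniform (C : gclass) (I I' K T : finType) (P : T -> gpred (I + I')) :
  no_config C -> (forall x, definable (P x)) ->
  exists n, forall x G, C G -> ~ config K (P x) n G.
Proof.
move=> noc dP; apply: (@finite_bound T (fun x n => forall G, C G -> ~ config K (P x) n G)).
  by move=> x m n mn H G CG /(config_mono mn); exact: H.
by move=> x; exact: noc.
Qed.

Lemma disjoint_on_sub (G : graph) (B : nat -> {set gV G}) (idx idx' : seq nat) :
  {subset idx' <= idx} -> disjoint_on B idx -> disjoint_on B idx'.
Proof. by move=> sub dis i j x ii jj; apply: dis; apply: sub. Qed.

(** The next ball of [i] is to consist of the [z] with [Dp z i]: those in the old ball or separated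
    there from their sample row [a z]. By Ramsey, either no two indices share such a [z] and the new
    balls are disjoint, or all pairs do; then, once the attached vertices have no foreign
    exceptions, the shared vertices form a configuration for [pair_pred]. *)
Lemma ball_step (C : gclass) h (J W : finType) k :
  (forall G, C G -> ~ half_graph h G) -> no_config C ->
  exists J' : finType, forall n, exists M, forall G, C G -> gV G ->
  forall (s : J -> gV G) (w : nat -> W -> gV G) (Fs : seq (link J)) (idx : seq nat),
  size Fs = k -> sorted ltn idx -> M <= size idx ->
  disjoint_on (fun i => ball (w i) s Fs) idx ->
  exists (s' : J' -> gV G) (F : link (J + J')%type) idx',
    [/\ subseq idx' idx, size idx' = n &
        disjoint_on (fun i => ball (w i) (sumf s s') (F :: map (@lift_link J J') Fs)) idx'].
Proof.
move=> noh noc.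
have [nX nXP] := no_config_uniform 'I_k.+1 noc
  (fun Fs : k.-tuple (link J) => @definable_row_pred _ W Fs).
have [t [MX MXP]] := distinct_rows_config J W k h nX.
pose J' : finType := ('I_t + 'I_5 * ('I_t * 'I_t))%type.
(* Witnesses of a pair: the shared vertex, for [None], and for each of the two indices a path of
   [k.+1] vertices in the old ball. *)
pose K : finType := (option 'I_k.+1 * bool)%type.
have [nY nYP] := no_config_uniform K noc
  (fun Fs : k.+1.-tuple (link (J + J')%type) => @definable_pair_pred _ W Fs).
exists J' => n.
pose vsz := #|K| + (#|W| + (#|W| + (#|{: 'I_t * 'I_t}| + #|{: 'I_t * 'I_t}|))).
have /choice[N3 N3P] := fun c => free_set c (5 + (nY + nY)).
have /choice[N2 N2P] := fun q => ramsey 2 bool q.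
(* The second summand pays for the indices that are exceptional for a vertex of [L] below. *)
pose Psi d := N2 (maxn (5 + n) (N3 (vsz * d.+1))) + (t + #|J|).+1 * d.+1.
have [M MP] := sample_set t MX h Psi.
exists M => G CG x0 s w Fs idx sF sidx Midx dis.
have nh := noh G CG.
pose B i := ball (w i) s Fs.
have [|Z [d [idx1 [uZ sZ sub1 Psi1 [pd smp]]]]] := MP G nh B idx x0 _ sidx Midx.
  move=> Z' idx' uZ' sZ' sub' Mi' pd'.
  have sFt : size Fs == k by rewrite sF.
  apply: (nXP (Tuple sFt) G CG).
  apply: (MXP G nh s w Fs idx' Z') => //; first exact: (subseq_sorted ltn_trans sub' sidx).
  exact: (disjoint_on_sub (mem_subseq sub') dis).
have /choice[a aP] : forall z, exists z', z' \in Z /\ count (fun i => diff (B i) z z') idx1 <= d.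
  by move=> z; have [z' ? ?] := smp z; exists z'.
have aZ z : a z \in Z by have [] := aP z.
have ad z : count (fun i => diff (B i) z (a z)) idx1 <= d by have [] := aP z.
have sidx1 := subseq_sorted ltn_trans sub1 sidx.
have dis1 : disjoint_on B idx1 := disjoint_on_sub (mem_subseq sub1) dis.
pose Dp z i := (z \in B i) || diff (B i) z (a z).
have Dpd z : count (Dp z) idx1 <= d.+1.
  have := count_predUI (fun i => z \in B i) (fun i => diff (B i) z (a z)) idx1.
  have := count_disjoint z (sorted_ltn_uniq sidx1) dis1; have := ad z.
  have arith (u v x y e : nat) : u <= d -> v <= 1 -> x + y = v + u -> x <= d.+1 by clear; lia.
  exact: arith.
(* [x0] is listed because it is the default of [nth] beyond the end of [Z], and so may itself become
   a parameter. *)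
pose L := x0 :: Z ++ [seq s j | j <- enum J].
pose idx2 := [seq i <- idx1 | ~~ has (fun x => Dp x i) L].
have sub2 : subseq idx2 idx1 := filter_subseq _ _.
have noL x i : x \in L -> i \in idx2 -> ~~ Dp x i.
  by move=> xL; rewrite mem_filter => /andP[/hasPn/(_ x xL)].
have s2 : N2 (maxn (5 + n) (N3 (vsz * d.+1))) <= size idx2.
  have e := count_negb (fun i => has (fun x => Dp x i) L) idx1.
  have c : count (fun i => has (fun x => Dp x i) L) idx1 <= size L * d.+1.
    by apply: count_has_le => x _; exact: Dpd.
  have szL : size L * d.+1 <= (t + #|J|).+1 * d.+1.
    by rewrite leq_mul2r /= size_cat size_map -cardE ltnS leq_add2r sZ.
  rewrite size_filter; move: Psi1; rewrite /Psi -e.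
  have arith (u v x y b : nat) : v <= x -> x <= b -> y + b <= u + v -> y <= u by clear; lia.
  exact: arith c szL.
have sidx2 := subseq_sorted ltn_trans sub2 sidx1.
have [idx3 [b [sub3 s3 H3]]] := N2P _ (fun r => [exists z, Dp z (nth 0 r 0) && Dp z (nth 0 r 1)])
  idx2 sidx2 s2.
have sidx3 := subseq_sorted ltn_trans sub3 sidx2.
have col i j : i \in idx3 -> j \in idx3 -> i < j -> [exists z, Dp z i && Dp z j] = b.
  move=> i3 j3 ij; have := H3 [:: i; j]; rewrite /= ij => /(_ isT) H'; apply: H' => //.
  by move=> x; rewrite !inE => /orP[]/eqP->.
have nxp p i : exists v, nth x0 Z (p : 'I_t * 'I_t).1 \in Z -> nth x0 Z p.2 \in Z ->
    nth x0 Z p.1 != nth x0 Z p.2 -> i \in idx1 ->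
    v \in B i /\ gE (nth x0 Z p.1) v != gE (nth x0 Z p.2) v.
  case: (pselect (diff (B i) (nth x0 Z p.1) (nth x0 Z p.2))) => [/exists_inP[v vB ne]|nd].
    by exists v.
  by exists x0 => z1 z2 ne i1; case: nd; apply: pd.
have /choice[y0 y0P] := fun q : ('I_t * 'I_t) * nat => nxp q.1 q.2.
pose y p i := y0 (p, i).
have yP p i : i \in idx1 -> nth x0 Z (p : 'I_t * 'I_t).1 \in Z -> nth x0 Z p.2 \in Z ->
    nth x0 Z p.1 != nth x0 Z p.2 ->
    y p i \in B i /\ gE (nth x0 Z p.1) (y p i) != gE (nth x0 Z p.2) (y p i).
  by move=> i1 z1 z2 ne; exact: (y0P (p, i)).
have links T0 : size T0 = 5 -> {subset T0 <= idx1} -> exists (s' : J' -> gV G) (F : link (J + J')%type),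
    [/\ (forall b, s' (inl b) = nth x0 Z b), (forall q, s' (inr q) = y q.2 (nth 0 T0 q.1)) &
    forall x z, count (fun i => diff (B i) z (a z)) T0 <= 2 ->
      mis (sumf s s') F x z = (gE z x != gE (a z) x)].
  move=> sT subT.
  have [|F FP] := @test_link J t G B T0 Z a x0 y s sZ sT aZ.
    by move=> p i iT; apply: yP; exact: subT.
  by eexists; exists F; split; [| |exact: FP].
have mem3 := mem_subseq sub3; have mem2 := mem_subseq sub2.
(* The new link predicts correctly for vertices with at most two exceptional tests, so for them the
   grown ball is exactly [Dp]. *)
have inB s' (F : link (J + J')%type) T0 i z :
    (forall x z, count (fun i => diff (B i) z (a z)) T0 <= 2 ->
      mis (sumf s s') F x z = (gE z x != gE (a z) x)) ->
    count (fun i => diff (B i) z (a z)) T0 <= 2 ->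
    (z \in ball (w i) (sumf s s') (F :: map (@lift_link J J') Fs)) = Dp z i.
  move=> FP gz; rewrite !inE /= reach_lift /Dp inE; congr (_ || _).
  by apply: eq_existsb => x; rewrite reach_lift FP // !inE.
case: b col {H3} => col; last first.
  (* When no two indices share a vertex, every vertex has at most one exceptional test; five indices
     are spent as tests. *)
  pose T0 := take 5 idx3.
  have szT : size T0 = 5 by rewrite size_takel // s3 (leq_trans _ (leq_maxl _ _)).
  have subT : {subset T0 <= idx3} by move=> i /mem_take.
  have [|s' [F [_ _ FP]]] := links T0 szT; first by move=> i /subT/mem3/mem2.
  have uni z i j : i \in idx3 -> j \in idx3 -> Dp z i -> Dp z j -> i = j.
    move=> i3 j3 Di Dj; case: (ltngtP i j) => // ij.
      by have /negbT/existsPn/(_ z) := col i j i3 j3 ij; rewrite Di Dj.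
    by have /negbT/existsPn/(_ z) := col j i j3 i3 ij; rewrite Di Dj.
  exists s', F, (take n (drop 5 idx3)); split.
  - apply: subseq_trans (take_subseq _ _) _; apply: subseq_trans (drop_subseq _ _) _.
    by apply: subseq_trans sub3 _; apply: subseq_trans sub2 sub1.
  - rewrite size_takel // size_drop s3; have := leq_maxl (5 + n) (N3 (vsz * d.+1)).
    by move: (maxn _ _) => q; clear; lia.
  - move=> i j z /mem_take/mem_drop i3 /mem_take/mem_drop j3.
    have gz : count (fun i => diff (B i) z (a z)) T0 <= 2.
      case: (pselect (exists2 l, l \in T0 & diff (B l) z (a z))) => [[l lT Dl]|nl].
        apply: (@count_le2 _ _ l l); first by rewrite take_uniq // sorted_ltn_uniq.
        by move=> l' l'T Dl'; left; apply: (uni z); rewrite ?subT // /Dp ?Dl ?Dl' orbT.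
      rewrite (eq_in_count (a2 := pred0)) ?count_pred0 // => l lT /=.
      by apply/negbTE/negP => Dl; apply: nl; exists l.
    by rewrite !(inB _ _ _ _ _ FP gz); exact: uni.
have /choice[zz0 zz0P] : forall q : nat * nat, exists z, q.1 \in idx3 -> q.2 \in idx3 -> q.1 < q.2 ->
    Dp z q.1 && Dp z q.2.
  move=> [i j] /=; case: (pselect [/\ i \in idx3, j \in idx3 & i < j]) => [[i3 j3 ij]|ne].
    by have /existsP[z zP] := col i j i3 j3 ij; exists z.
  by exists x0 => i3 j3 ij; case: ne.
pose zz i j := zz0 (i, j).
have zzP i j : i \in idx3 -> j \in idx3 -> i < j -> Dp (zz i j) i && Dp (zz i j) j := zz0P (i, j).
(* The reason for [Dp z i]: the vertex itself if it is in the ball, otherwise a ball vertex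
   separating [z] from [a z]. *)
have /choice[wt wtP] : forall q : nat * gV G, exists x, Dp q.2 q.1 ->
    x \in B q.1 /\ (x = q.2 \/ gE q.2 x != gE (a q.2) x).
  move=> [i z] /=; case: (boolP (z \in B i)) => [zB|nz]; first by exists z; split=> //; left.
  case: (pselect (diff (B i) z (a z))) => [/exists_inP[x xB ne]|nd].
    by exists x; split=> //; right.
  by exists x0; rewrite /Dp (negbTE nz) /= => /nd.
have /choice[ch chP] := fun i => reach_chain_fun (w i) s Fs.
have sFE : (size Fs).+1 = k.+1 by rewrite sF.
pose pv i j (u : K) : gV G := let c := if u.2 then i else j in
  if u.1 is Some l then ch c (wt (c, zz i j)) (cast_ord (esym sFE) l) else zz i j.
pose vl i j : seq (gV G) := [seq pv i j u | u <- enum {: K}] ++ ([seq w i x | x <- enum W] ++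
  ([seq w j x | x <- enum W] ++ ([seq y p i | p <- enum {: 'I_t * 'I_t}] ++
    [seq y p j | p <- enum {: 'I_t * 'I_t}]))).
have szvl i j : size (vl i j) = vsz by rewrite /vl !size_cat !size_map /vsz !cardT !enumT.
(* Each vertex attached to a pair has at most [d.+1] exceptional indices, so on a suitable
   subsequence they all belong to the pair. *)
have [||idx4 [sub4 s4 free]] := N3P (vsz * d.+1) (fun i j l => has (fun v => Dp v l) (vl i j)) idx3 sidx3.
- by rewrite s3 leq_maxr.
- move=> i j _ _ _; apply: leq_trans (leq_count_subseq _ (subseq_trans sub3 sub2)) _.
  by rewrite -(szvl i j); apply: count_has_le => x _; exact: Dpd.
have mem4 := mem_subseq sub4.
have sidx4 := subseq_sorted ltn_trans sub4 sidx3.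
have fr i j l v : i \in idx4 -> j \in idx4 -> l \in idx4 -> i < j -> v \in vl i j -> Dp v l ->
    l = i \/ l = j.
  by move=> i4 j4 l4 ij vv Dv; apply: (free i j l) => //; apply/hasP; exists v.
pose T0 := take 5 idx4.
have szT : size T0 = 5 by rewrite size_takel // s4.
have subT : {subset T0 <= idx4} by move=> i /mem_take.
have [|s' [F [s'l s'r FP]]] := links T0 szT; first by move=> i /subT/mem4/mem3/mem2.
have goodvl i j v : i \in idx4 -> j \in idx4 -> i < j -> v \in vl i j ->
    count (fun i => diff (B i) v (a v)) T0 <= 2.
  move=> i4 j4 ij vv; apply: (@count_le2 _ _ i j); first by rewrite take_uniq // sorted_ltn_uniq.
  by move=> l /subT l4 Dl; apply: (fr i j l v) => //; rewrite /Dp Dl orbT.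
pose e q := nth 0 idx4 q.
have e4 q : q < 5 + (nY + nY) -> e q \in idx4 by move=> lt; rewrite mem_nth ?s4.
have elt q q' : q < q' -> q' < 5 + (nY + nY) -> e q < e q'.
  by move=> lt lt'; apply: (sorted_ltn_nth ltn_trans) => //; rewrite inE s4 // (ltn_trans lt).
have einj q q' : q < 5 + (nY + nY) -> q' < 5 + (nY + nY) -> e q = e q' -> q = q'.
  move=> lq lq' /eqP; rewrite nth_uniq ?s4 //; first by move/eqP.
  exact: sorted_ltn_uniq.
have eT q : q < 5 -> nth 0 T0 q = e q by move=> lt; rewrite nth_take.
(* A vertex attached to a single index has an exception only there: compare two pairs. *)
have own q v l : q < 5 + (nY + nY) -> (forall q', q' < q -> v \in vl (e q') (e q)) ->
    (forall q', q < q' -> v \in vl (e q) (e q')) -> l < 5 + (nY + nY) -> Dp v (e l) -> l = q.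
  move=> lq v1 v2 ll Dv.
  have pr q' : q' < 5 -> q' != q -> l = q' \/ l = q.
    move=> q'5 ne; have lq' : q' < 5 + (nY + nY) by rewrite (leq_trans q'5) ?leq_addr.
    case: (ltngtP q' q) ne => // qq _.
      have [/einj E|/einj E] := fr _ _ _ _ (e4 _ lq') (e4 _ lq) (e4 _ ll) (elt _ _ qq lq) (v1 _ qq) Dv;
        by [left; apply: E|right; apply: E].
    have [/einj E|/einj E] := fr _ _ _ _ (e4 _ lq) (e4 _ lq') (e4 _ ll) (elt _ _ qq lq') (v2 _ qq) Dv;
      by [right; apply: E|left; apply: E].
  have [q1 [q2 [q15 q25 ne1 ne2 ne]]] : exists q1 q2, [/\ q1 < 5, q2 < 5, q1 != q, q2 != q & q1 != q2].
    case: q {lq v1 v2 pr} => [|[|q]]; [by exists 1, 2|by exists 0, 2|by exists 0, 1].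
  have [E1|//] := pr q1 q15 ne1; have [E2|//] := pr q2 q25 ne2.
  by rewrite -E1 E2 eqxx in ne.
have own_w q x l : q < 5 + (nY + nY) -> l < 5 + (nY + nY) -> Dp (w (e q) x) (e l) -> l = q.
  have xw : w (e q) x \in [seq w (e q) x' | x' <- enum W] by apply: map_f; rewrite mem_enum.
  by move=> lq; apply: own => // q' _; rewrite !mem_cat xw ?orbT.
have own_y q p l : q < 5 + (nY + nY) -> l < 5 + (nY + nY) -> Dp (y p (e q)) (e l) -> l = q.
  have xy : y p (e q) \in [seq y p' (e q) | p' <- enum {: 'I_t * 'I_t}].
    by apply: (map_f (fun p' => y p' (e q))); rewrite mem_enum.
  by move=> lq; apply: own => // q' _; rewrite !mem_cat xy ?orbT.
have good_own v q : (forall l, l < 5 + (nY + nY) -> Dp v (e l) -> l = q) ->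
    count (fun i => diff (B i) v (a v)) T0 <= 2.
  move=> H; apply: (@count_le2 _ _ (e q) (e q)); first by rewrite take_uniq // sorted_ltn_uniq.
  move=> l lT Dl; left; have := subT _ lT => /(nthP 0)[l' l'4 lE].
  by rewrite -lE -/(e l') (H l') -?s4 // /e lE /Dp Dl orbT.
have good_none v : v \in L -> count (fun i => diff (B i) v (a v)) T0 <= 2.
  move=> vL; rewrite (eq_in_count (a2 := pred0)) ?count_pred0 // => l /subT/mem4/mem3 l2.
  by have := noL v l vL l2; rewrite /Dp negb_or => /andP[_ /negbTE].
have rlt (q : 'I_nY) : 5 + q < 5 + (nY + nY) by have := ltn_ord q; clear; lia.
have clt (q : 'I_nY) : 5 + (nY + q) < 5 + (nY + nY) by have := ltn_ord q; clear; lia.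
have rc (q c : 'I_nY) : 5 + q < 5 + (nY + c) by have := ltn_ord q; clear; lia.
have sFt : size (F :: map (@lift_link J J') Fs) == k.+1 by rewrite /= size_map sF.
(* The first five indices are tests, the next [nY] give the rows and the last [nY] the columns. *)
case: (nYP (Tuple sFt) G CG); exists (fun q => w (e (5 + q))),
  (fun c => sumf (w (e (5 + (nY + c)))) (sumf s s')), (fun q c => pv (e (5 + q)) (e (5 + (nY + c)))).
move=> q c X; set i := e (5 + q); set j := e (5 + (nY + c)).
have [i4 j4 ij] : [/\ i \in idx4, j \in idx4 & i < j] by split; [exact: e4|exact: e4|exact: elt].
have pvvl q' c' u : pv (e (5 + q')) (e (5 + (nY + c'))) u \in vl (e (5 + q')) (e (5 + (nY + c'))).
  by rewrite mem_cat map_f // mem_enum.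
split.
  move=> Xw Xs Xp; set z := zz i j.
  have /andP[Di Dj] : Dp z i && Dp z j by apply: zzP => //; exact: mem4.
  have gz : count (fun i => diff (B i) z (a z)) T0 <= 2.
    by apply: (goodvl i j) => //; exact: (pvvl _ _ (None, true)).
  have part (b : bool) l : l = (if b then i else j) -> Dp z l ->
      reach X (w l) (sumf s s') (F :: map (@lift_link J J') Fs) z.
    move=> lE Dl; have [xB xz] := wtP (l, z) Dl; set x := wt (l, z) in xB xz *; rewrite /= in xB xz.
    have [[l0 chl] _ chX] := chP l x xB.
    have chin m : ch l x m \in X.
      have := Xp (Some (cast_ord sFE m), b); rewrite /pv /= -/i -/j -lE -/z -/x.
      by rewrite (_ : cast_ord _ _ = m) //; exact: val_inj.
    have rx : reach X (w l) s Fs x by exact: chX.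
    rewrite /= reach_lift; case: xz => [xE|ne]; first by rewrite -xE rx.
    apply/orP; right; apply/exists_inP; exists x; first by rewrite -chl.
    by rewrite reach_lift rx FP.
  exists z; first exact: (Xp (None, true)).
  by split; [exact: (part true)|exact: (part false)].
move=> HX [z zX [rz1 rz2]].
pose Lam := F :: map (@lift_link J J') Fs.
have {}rz1 : reach X (w i) (sumf s s') Lam z by exact: rz1.
have {}rz2 : reach X (w j) (sumf s s') Lam z by exact: rz2.
have DD : count (fun i => diff (B i) z (a z)) T0 <= 2 -> Dp z i /\ Dp z j.
  move=> gz; rewrite -!(inB _ _ _ _ _ FP gz).
  by split; rewrite inE; [apply: reach_mono rz1|apply: reach_mono rz2]; exact: subsetT.
have no1 q' : (forall l, l < 5 + (nY + nY) -> Dp z (e l) -> l = q') -> False.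
  move=> H; have [Di Dj] := DD (good_own z q' H).
  have := H _ (rlt q) Di; have := H _ (clt c) Dj; have := rc q c; clear; lia.
have noL' : z \in L -> False.
  by move=> zL; have [Di _] := DD (good_none z zL); have := noL z i zL (mem3 _ (mem4 _ i4)); rewrite Di.
(* A vertex in both grown balls is exceptional for [i] and [j]. Centres and test vertices have at
   most one exceptional index, parameters and sample rows none, and a witness of another pair only
   the two of that pair. *)
have [[q' [x zE]]|[c' [[x|[m|[m|m]]] zE]]|[q' [c' [u [ne zE]]]]] := HX z zX.
- by apply: (no1 (5 + q')) => l ll; rewrite zE; exact: own_w.
- by apply: (no1 (5 + (nY + c'))) => l ll; rewrite zE; exact: own_w.
- apply: noL'; have -> : z = s m by rewrite zE.
  by rewrite inE mem_cat [X in _ || (_ || X)]map_f ?orbT // mem_enum.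
- apply: noL'; rewrite zE /= s'l inE mem_cat; case: (ltnP m (size Z)) => [mZ|mZ].
    by rewrite mem_nth ?orbT.
  by rewrite nth_default ?eqxx.
- move: zE; rewrite /= s'r eT // => zE.
  have lm : m.1 < 5 + (nY + nY) by rewrite (leq_trans (ltn_ord m.1)) ?leq_addr.
  by apply: (no1 m.1) => l ll; rewrite zE; exact: own_y.
have z' : z \in vl (e (5 + q')) (e (5 + (nY + c'))) by rewrite zE.
have [Di Dj] := DD (goodvl _ _ z (e4 _ (rlt q')) (e4 _ (clt c')) (elt _ _ (rc q' c') (clt c')) z').
have f l l4 Dl := fr _ _ l z (e4 _ (rlt q')) (e4 _ (clt c')) l4 (elt _ _ (rc q' c') (clt c')) z' Dl.
have ir := einj _ _ (rlt q); have ic := einj _ _ (clt c).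
apply: ne; have [E1 E2] : q' = q /\ c' = c; last by rewrite E1 E2.
have [lq lq'] := (ltn_ord q, ltn_ord q').
case: (f i i4 Di) => [/(ir _ (rlt _)) E1|/(ir _ (clt _)) E1]; last by exfalso; clear - E1 lq; lia.
case: (f j j4 Dj) => [/(ic _ (rlt _)) E2|/(ic _ (clt _)) E2]; first by exfalso; clear - E2 lq'; lia.
by split; apply: val_inj => /=; [clear - E1|clear - E2]; lia.
Qed.

(** * The exchange game *)

(** The parameter type is fixed before [n], so that the number of local types used later does not
    depend on how many balls are requested. *)
Lemma ball_iter (C : gclass) h (W : finType) R :
  (forall G, C G -> ~ half_graph h G) -> no_config C ->
  exists J : finType, forall n, exists M, forall G, C G -> gV G ->
  forall (w : nat -> W -> gV G) (idx : seq nat), sorted ltn idx -> M <= size idx ->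
  (forall i j a b, i \in idx -> j \in idx -> w i a = w j b -> i = j) ->
  exists (s : J -> gV G) (Fs : seq (link J)) idx',
    [/\ size Fs = R, subseq idx' idx, size idx' = n &
        disjoint_on (fun i => ball (w i) s Fs) idx'].
Proof.
move=> noh noc; elim: R => [|R [J IH]].
  exists void => n; exists n => G CG x0 w idx sidx nidx dis.
  exists (fun v : void => match v with end), [::], (take n idx); split=> //.
  - exact: take_subseq.
  - by rewrite size_takel.
  - move=> i j x /mem_take ii /mem_take jj; rewrite !inE /= => /existsP[a /eqP->] /existsP[b /eqP e].
    exact: dis ii jj e.
have [J' step] := @ball_step C h J W R noh noc.
exists (J + J')%type => n; have [M MP] := step n; have [M' M'P] := IH M.
exists M' => G CG x0 w idx sidx Midx dis.
have [s [Fs [idx1 [sF sub1 s1 dis1]]]] := M'P G CG x0 w idx sidx Midx dis.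
have sidx1 := subseq_sorted ltn_trans sub1 sidx.
have [s' [F [idx2 [sub2 s2 dis2]]]] := MP G CG x0 s w Fs idx1 sF sidx1 (eq_leq (esym s1)) dis1.
exists (sumf s s'), (F :: map (@lift_link J J') Fs), idx2; split=> //.
  by rewrite /= size_map sF.
exact: subseq_trans sub2 sub1.
Qed.

(** * Local types and back-and-forth *)

Fixpoint qrank n (phi : formula n) : nat :=
  match phi with
  | FEdge _ _ _ => 0
  | FEq _ _ _ => 0
  | FNot _ p => qrank p
  | FAnd _ p q => maxn (qrank p) (qrank q)
  | FEx _ p => (qrank p).+1
  end.

Section LocalTypes.
Variables (T : finType) (R : nat).

(** [None] marks a position not played on this side; for the others, the colour and the levels up to
    [R] containing the vertex are recorded. *)
Definition atom_type n : finType :=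
  ({ffun 'I_n -> option (T * {set 'I_R.+1})} * {ffun 'I_n * 'I_n -> bool * bool})%type.

(** Types with [k] rounds left: the second component treats the next vertex as played elsewhere, the
    third collects the types obtained by playing it in the outermost ball. Finiteness allows the
    pigeonhole principle. *)
Fixpoint local_type k n : finType :=
  if k is k'.+1 then (atom_type n * local_type k' n.+1 * {set local_type k' n.+1})%type
  else atom_type n.

Variables (G : graph) (chi : gV G -> T).
Implicit Types B : nat -> {set gV G}.

Definition atom B n (e : 'I_n -> option (gV G)) : atom_type n :=
  ([ffun i => omap (fun v => (chi v, [set l : 'I_R.+1 | v \in B l])) (e i)],
   [ffun ij => if (e ij.1, e ij.2) is (Some x, Some y) then (gE x y, x == y) else (false, false)]).

Fixpoint ltype B k n (e : 'I_n -> option (gV G)) : local_type k n :=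
  match k return local_type k n with
  | 0 => atom B e
  | k'.+1 => (atom B e, ltype B k' (ext_env None e),
      [set ltype B k' (ext_env (Some c) e) | c in B R])
  end.

Lemma ltype_atom B B' k n (e e' : 'I_n -> option (gV G)) :
  ltype B k e = ltype B' k e' -> atom B e = atom B' e'.
Proof. by case: k => [//|k] /(congr1 (fun t => t.1.1)). Qed.

Lemma ltypeS_eq B B' k n (e e' : 'I_n -> option (gV G)) :
  ltype B k.+1 e = ltype B' k.+1 e' ->
  ltype B k (ext_env None e) = ltype B' k (ext_env None e') /\
  [set ltype B k (ext_env (Some c) e) | c in B R] = [set ltype B' k (ext_env (Some c) e') | c in B' R].
Proof.
by move=> E; split; [have := congr1 (fun t => t.1.2) E|have := congr1 (fun t => t.2) E].
Qed.

Definition local n (p : 'I_n -> option bool) (b : bool) (e : 'I_n -> gV G) (a : 'I_n) :=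
  if p a == Some b then Some (e a) else None.

Lemma local_ext n (p : 'I_n -> option bool) b (e : 'I_n -> gV G) x o :
  local (ext_env o p) b (ext_env x e) = ext_env (if o == Some b then Some x else None) (local p b e).
Proof. by apply: funext => a; rewrite /local /ext_env; case: unlift. Qed.

(* Positions [a] with [p a = Some true] are local to B on the left and to B' on the right,
   those with [Some false] the other way round, and the remaining ones are played identically. *)
Record swapped B B' k n (p : 'I_n -> option bool) (e e' : 'I_n -> gV G) lo hi : Prop := Swapped {
  sw_true : ltype B k (local p true e) = ltype B' k (local p true e');
  sw_false : ltype B' k (local p false e) = ltype B k (local p false e');
  sw_le : lo + 2 ^ k <= hi <= R;
  sw_T : forall a, p a = Some true -> e a \in B lo /\ e' a \in B' lo;
  sw_F : forall a, p a = Some false -> e a \in B' lo /\ e' a \in B lo;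
  sw_N : forall a, p a = None -> [/\ e a = e' a, e a \notin B hi & e a \notin B' hi] }.

(** The same [g] governs both families, so colours determine adjacency across a layer alike on
    either side of the exchange. *)
Definition layered B B' : Prop :=
  [/\ forall l l', l <= l' <= R -> B l \subset B l' /\ B' l \subset B' l',
      forall x, x \in B R -> x \in B' R -> False &
      forall l, l < R -> exists g : T -> T -> bool, forall x z,
        (x \in B l) && (z \notin B l.+1) || (x \in B' l) && (z \notin B' l.+1) ->
        gE x z = g (chi x) (chi z)].

Lemma layered_sym B B' : layered B B' -> layered B' B.
Proof.
move=> [mono dis pr]; split.
- by move=> l l' /mono[].
- by move=> x ? ?; apply: (dis x).
- by move=> l /pr[g gP]; exists g => x z; rewrite orbC; exact: gP.
Qed.

Lemma swapped_sym B B' k n (p : 'I_n -> option bool) e e' lo hi :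
  swapped B B' k p e e' lo hi -> swapped B' B k p e' e lo hi.
Proof.
move=> [tt ff le sT sF sN]; split=> //.
- by move=> a /sT[].
- by move=> a /sF[].
- by move=> a /sN[-> ? ?].
Qed.

(** Exchanging the names of the families turns [Some false] positions into [Some true] ones, so that
    only the latter need separate treatment. *)
Lemma swapped_flip B B' k n (p : 'I_n -> option bool) e e' lo hi :
  swapped B B' k p e e' lo hi -> swapped B' B k (omap negb \o p) e e' lo hi.
Proof.
have loc b (f : 'I_n -> gV G) : local (omap negb \o p) b f = local p (~~ b) f.
  by apply: funext => a; rewrite /local /=; case: (p a) b => [[]|] [].
move=> [tt ff le sT sF sN]; split; rewrite ?loc //= => a.
- by case E: (p a) => [[]|] // _; exact: sF.
- by case E: (p a) => [[]|] // _; exact: sT.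
- by case E: (p a) => [[]|] // _; have [? ? ?] := sN a E.
Qed.

Lemma swapped_col B B' k n (p : 'I_n -> option bool) e e' lo hi a :
  swapped B B' k p e e' lo hi -> chi (e a) = chi (e' a).
Proof.
move=> [tt ff _ _ _ sN]; case E: (p a) => [[]|].
- by have [/ffunP/(_ a)] := ltype_atom tt; rewrite !ffunE /local E /= => -[].
- by have [/ffunP/(_ a)] := ltype_atom ff; rewrite !ffunE /local E /= => -[].
- by have [-> _ _] := sN a E.
Qed.

Lemma swapped_local B B' k n (p : 'I_n -> option bool) e e' lo hi a b :
  swapped B B' k p e e' lo hi -> p a = Some true -> p b = Some true ->
  gE (e a) (e b) = gE (e' a) (e' b) /\ (e a == e b) = (e' a == e' b).
Proof.
move=> [tt _ _ _ _ _] pa pb.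
by have [_ /ffunP/(_ (a, b))] := ltype_atom tt; rewrite !ffunE /local pa pb /= => -[].
Qed.

(** Because [lo < hi], the second vertex is outside level [lo.+1] on both sides; both adjacencies
    are then the same function of the colours, which the exchange preserves. *)
Lemma swapped_mixed B B' k n (p : 'I_n -> option bool) e e' lo hi a b :
  layered B B' -> swapped B B' k p e e' lo hi -> p a = Some true -> p b <> Some true ->
  [/\ gE (e a) (e b) = gE (e' a) (e' b), e a <> e b & e' a <> e' b].
Proof.
move=> [mono dis pr] sw pa pb.
have /andP[lohi hiR] := sw_le sw.
have {}lohi : lo < hi by apply: leq_trans lohi; rewrite -addn1 leq_add2l expn_gt0.
have loR : lo < R by exact: leq_trans hiR.
have [g gP] := pr lo loR.
have up l l' x : l <= l' -> l' <= R -> (x \in B l -> x \in B l') /\ (x \in B' l -> x \in B' l').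
  by move=> ll' l'R; have [|s1 s2] := mono l l'; [rewrite ll'|split; apply/subsetP].
have [ea ea'] := sw_T sw pa.
have [eb eb'] : e b \notin B lo.+1 /\ e' b \notin B' lo.+1.
  case E: (p b) => [[]|]; first by rewrite E in pb.
    have [eb eb'] := sw_F sw E; split; apply/negP => H.
      by apply: (dis (e b)); [apply: (up lo.+1 R (e b) _ _).1|apply: (up lo R (e b) _ _).2] => //; exact: ltnW.
    by apply: (dis (e' b)); [apply: (up lo R (e' b) _ _).1|apply: (up lo.+1 R (e' b) _ _).2] => //; exact: ltnW.
  have [<- eb eb'] := sw_N sw E.
  by split; [apply: contra eb|apply: contra eb']; [apply: (up lo.+1 hi (e b) _ _).1|apply: (up lo.+1 hi (e b) _ _).2].
split.
- rewrite (gP (e a)) ?ea ?eb // (gP (e' a)) ?ea' ?eb' ?orbT //.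
  by rewrite (swapped_col a sw) (swapped_col b sw).
- by move=> E; move: eb; rewrite -E (up lo lo.+1 (e a) _ _).1.
- by move=> E; move: eb'; rewrite -E (up lo lo.+1 (e' a) _ _).2.
Qed.

Lemma swapped_atom B B' k n (p : 'I_n -> option bool) e e' lo hi a b :
  layered B B' -> swapped B B' k p e e' lo hi ->
  gE (e a) (e b) = gE (e' a) (e' b) /\ (e a = e b <-> e' a = e' b).
Proof.
move=> lay sw; have lay' := layered_sym lay; have sw' := swapped_flip sw.
have tt D D' q c d : layered D D' -> swapped D D' k q e e' lo hi -> q c = Some true ->
    gE (e c) (e d) = gE (e' c) (e' d) /\ (e c = e d <-> e' c = e' d).
  move=> lD sD qc; case: (pselect (q d = Some true)) => qd.
    have [-> E] := swapped_local sD qc qd; split=> //.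
    by split=> /eqP; [rewrite E|rewrite -E] => /eqP.
  by have [-> n1 n2] := swapped_mixed lD sD qc qd.
have flip x y : gE (e y) (e x) = gE (e' y) (e' x) /\ (e y = e x <-> e' y = e' x) ->
    gE (e x) (e y) = gE (e' x) (e' y) /\ (e x = e y <-> e' x = e' y).
  move=> [E1 [E2 E3]]; rewrite gE_sym E1 gE_sym; split=> //.
  by split=> H; apply/esym; [apply: E2|apply: E3].
case Ea: (p a) => [[]|]; first exact: (tt _ _ _ _ _ lay sw).
  by apply: (tt _ _ _ _ _ lay' sw'); rewrite /= Ea.
case Eb: (p b) => [[]|]; first by apply: flip; exact: (tt _ _ _ _ _ lay sw).
  by apply: flip; apply: (tt _ _ _ _ _ lay' sw'); rewrite /= Eb.
by have [-> _ _] := sw_N sw Ea; have [-> _ _] := sw_N sw Eb.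
Qed.

(** Equal sets of outer-ball types provide a reply in [B' R]; since types record levels, it also
    lies in level [lo + 2 ^ k], like [c]. *)
Lemma swapped_ext_near B B' k n (p : 'I_n -> option bool) e e' lo hi c :
  layered B B' -> swapped B B' k.+1 p e e' lo hi -> c \in B (lo + 2 ^ k) ->
  exists c', swapped B B' k (ext_env (Some true) p) (ext_env c e) (ext_env c' e') (lo + 2 ^ k) hi.
Proof.
move=> lay [tt ff le sT sF sN] cB; have [mono dis pr] := lay.
have {}le : lo + 2 ^ k + 2 ^ k <= hi <= R by rewrite -addnA addnn -mul2n -expnS.
set mid := lo + 2 ^ k in cB le *.
have midR : mid <= R by apply: leq_trans (_ : hi <= R); [apply: leq_trans (leq_addr _ _) _|]; case/andP: le; eauto.
have cR : c \in B R by have [|s1 s2] := mono mid R; [rewrite midR leqnn|apply: (subsetP s1)].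
have [_ tset] := ltypeS_eq tt; have [fN _] := ltypeS_eq ff.
have : ltype B k (ext_env (Some c) (local p true e)) \in
    [set ltype B k (ext_env (Some c) (local p true e)) | c in B R] by apply: imset_f.
rewrite tset => /imsetP[c' c'R tE]; exists c'.
have c'B : c' \in B' mid.
  have [/ffunP/(_ ord0)] := ltype_atom tE; rewrite !ffunE /ext_env unlift_none /= => -[_ /setP lev] _.
  have m1 : mid < R.+1 by rewrite ltnS.
  by have := lev (Ordinal m1); rewrite !inE /= cB => /esym.
have [|s1 s2] := mono lo mid; first by rewrite leq_addr.
split=> //; rewrite ?local_ext ?eqxx //= => a; rewrite /ext_env; case: (unlift ord0 a) => [b|] //.
- by move=> /sT[eb eb']; split; [apply: (subsetP s1)|apply: (subsetP s2)].
- by move=> /sF[eb eb']; split; [apply: (subsetP s2)|apply: (subsetP s1)].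
- exact: sN.
Qed.

(** The required gap between [lo] and [hi] halves in each round. A move within the middle level of
    either ball is answered by type and raises [lo]; any other move is answered by itself and lowers
    [hi]. *)
Lemma swapped_ext B B' k n (p : 'I_n -> option bool) e e' lo hi c :
  layered B B' -> swapped B B' k.+1 p e e' lo hi ->
  exists B1 B1' p' c' lo' hi', layered B1 B1' /\
    swapped B1 B1' k p' (ext_env c e) (ext_env c' e') lo' hi'.
Proof.
move=> lay sw; set mid := lo + 2 ^ k.
case: (boolP (c \in B mid)) => [cB|nB].
  have [c' H] := swapped_ext_near lay sw cB.
  by exists B, B', (ext_env (Some true) p), c', mid, hi.
have lay' := layered_sym lay.
case: (boolP (c \in B' mid)) => [cB|nB'].
  have [c' H] := swapped_ext_near lay' (swapped_flip sw) cB.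
  by exists B', B, (ext_env (Some true) (omap negb \o p)), c', mid, hi.
exists B, B', (ext_env None p), c, lo, mid; split=> //.
case: sw => tt ff le sT sF sN.
have {}le : lo + 2 ^ k + 2 ^ k <= hi <= R by rewrite -addnA addnn -mul2n -expnS.
have /andP[midhi hiR] : mid <= hi <= R.
  by case/andP: le => le ->; rewrite (leq_trans (leq_addr _ _) le).
have [tN _] := ltypeS_eq tt; have [fN _] := ltypeS_eq ff.
split; rewrite ?local_ext //= ?leqnn ?(leq_trans midhi) // => a; rewrite /ext_env;
  case: (unlift ord0 a) => [b|] //.
- exact: sT.
- exact: sF.
- move=> /sN[E n1 n2]; have [|s1 s2] := (let: And3 m _ _ := lay in m) mid hi; first by rewrite midhi.
  by split=> //; [apply: contra n1|apply: contra n2]; apply/subsetP.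
Qed.

(** The replies of [swapped_ext] form a winning strategy. The families vary in the induction, as a
    move near the second ball exchanges their roles. *)
Lemma swapped_sat n (phi : formula n) : forall k B B' (p : 'I_n -> option bool) e e' lo hi,
  qrank phi <= k -> layered B B' -> swapped B B' k p e e' lo hi -> sat phi e <-> sat phi e'.
Proof.
elim: phi => {n} [n i j|n i j|n f IH|n f IHf g IHg|n f IH] k B B' p e e' lo hi /= le lay sw.
- by have [-> _] := swapped_atom i j lay sw.
- by have [_ ->] := swapped_atom i j lay sw.
- by rewrite (IH _ _ _ _ _ _ _ _ le lay sw).
- move: le; rewrite geq_max => /andP[le1 le2].
  by rewrite (IHf _ _ _ _ _ _ _ _ le1 lay sw) (IHg _ _ _ _ _ _ _ _ le2 lay sw).
case: k le sw => [//|k] le sw.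
split=> -[c sc].
  have [B1 [B1' [p' [c' [lo' [hi' [lay' sw']]]]]]] := swapped_ext c lay sw.
  by exists c'; rewrite -(IH _ _ _ _ _ _ _ _ le lay' sw').
have [B1 [B1' [p' [c' [lo' [hi' [lay' sw']]]]]]] := swapped_ext c (layered_sym lay) (swapped_sym sw).
by exists c'; rewrite -(IH _ _ _ _ _ _ _ _ le lay' sw').
Qed.

End LocalTypes.

(** The head of [Fs] is the last link, so level [l] drops the first [R - l] entries. A vertex
    outside level [l.+1] is mispredicted by no vertex of level [l], so the link itself is the
    function of colours. *)
Lemma ball_layered (J W : finType) (G : graph) (s : J -> gV G) (Fs : seq (link J)) R
  (w w' : W -> gV G) : size Fs = R ->
  (forall x, x \in ball w s Fs -> x \in ball w' s Fs -> False) ->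
  layered R (tp s) (fun l => ball w s (drop (R - l) Fs)) (fun l => ball w' s (drop (R - l) Fs)).
Proof.
move=> sF dis.
have mono1 (u : W -> gV G) l : ball u s (drop l.+1 Fs) \subset ball u s (drop l Fs).
  apply/subsetP => x; rewrite !inE; case: (ltnP l (size Fs)) => lt.
    by case: Fs lt {sF dis} => // F Fs lt; rewrite (drop_nth F lt) /= => ->.
  by rewrite !drop_oversize // ltnW.
have mono (u : W -> gV G) a b : b <= a -> ball u s (drop a Fs) \subset ball u s (drop b Fs).
  move=> /subnK <-; elim: (a - b) => [//|c IH]; exact: subset_trans (mono1 _ _) IH.
split.
- by move=> l l' /andP[ll' _]; split; apply: mono; rewrite leq_sub2l.
- by move=> x; rewrite subnn drop0; exact: dis.
move=> l lR; have lt : R - l.+1 < size Fs by rewrite sF; lia.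
have [F0 _] : exists F0 : link J, True by case: Fs lt {sF dis mono1 mono} => // F; exists F.
exists (fun a b => nth F0 Fs (R - l.+1) (a, b)) => x z.
have E : drop (R - l.+1) Fs = nth F0 Fs (R - l.+1) :: drop (R - l) Fs.
  by rewrite (drop_nth F0 lt); congr (_ :: drop _ _); lia.
have one (u : W -> gV G) : (x \in ball u s (drop (R - l) Fs)) && (z \notin ball u s (drop (R - l.+1) Fs)) ->
    gE x z = nth F0 Fs (R - l.+1) (tp s x, tp s z).
  rewrite E !inE /= negb_or => /and3P[rx _ /exists_inPn/(_ x (in_setT _))].
  by rewrite rx /= /mis negbK => /eqP.
by case/orP; exact: one.
Qed.

(** [P] selects one block of variables, and [Kc] is the kernel of a sunflower of tuples. Among many
    petals two have the same pair of local types, and these are exchanged. *)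
Lemma swap_bound (C : gclass) h m (phi : formula m) (P : pred 'I_m) (Kc : {set 'I_m}) :
  (forall G, C G -> ~ half_graph h G) -> no_config C ->
  exists M, forall G, C G -> gV G -> forall (t : nat -> 'I_m -> gV G) (idx : seq nat),
  sorted ltn idx -> M <= size idx ->
  (forall i j a, i \in idx -> j \in idx -> a \in Kc -> t i a = t j a) ->
  (forall i j a b, i \in idx -> j \in idx -> a \notin Kc -> b \notin Kc -> t i a = t j b -> i = j) ->
  exists i j, [/\ i \in idx, j \in idx, i < j &
    sat phi (fun a => if P a then t i a else t j a) <-> sat phi (fun a => if P a then t j a else t i a)].
Proof.
move=> noh noc; pose W : finType := {x : 'I_m | x \notin Kc}.
pose q := qrank phi; pose R := 2 ^ q.
have [J HJ] := @ball_iter C h W R noh noc.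
pose Ty : finType := (local_type {set J} R q m * local_type {set J} R q m)%type.
(* At most [m] balls contain a kernel vertex and are dropped; what is left still forces two indices
   of equal type. *)
have [M MP] := HJ ((2 * #|Ty| + m).+1).
exists M => G CG x0 t idx sidx Midx const petal.
pose w i (x : W) := t i (val x).
have [|s [Fs [idx1 [sF sub1 s1 dis]]]] := MP G CG x0 w idx sidx Midx.
  by move=> i j a b ii jj; apply: petal => //; [exact: valP a|exact: valP b].
have sidx1 := subseq_sorted ltn_trans sub1 sidx.
have uidx1 := sorted_ltn_uniq sidx1.
pose i0 := nth 0 idx 0.
have i0P : i0 \in idx.
  by apply: mem_nth; apply: leq_trans (size_subseq sub1); rewrite s1.
pose L := [seq t i0 a | a <- enum Kc].
pose idx2 := [seq i <- idx1 | ~~ has (fun x => x \in ball (w i) s Fs) L].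
have sub2 : subseq idx2 idx1 := filter_subseq _ _.
have s2 : 2 * #|Ty| < size idx2.
  have e := count_negb (fun i => has (fun x => x \in ball (w i) s Fs) L) idx1.
  have c : count (fun i => has (fun x => x \in ball (w i) s Fs) L) idx1 <= size L * 1.
    by apply: count_has_le => x _; exact: count_disjoint.
  have szL : size L <= m.
    by rewrite size_map -cardE; apply: leq_trans (max_card _) _; rewrite card_ord.
  rewrite size_filter; move: e c szL; rewrite s1 muln1.
  by move: (count _ _) (count _ _) (size L) (2 * _); clear; lia.
pose Bl i l := ball (w i) s (drop (R - l) Fs).
pose side i (b : bool) a := if (P a == b) && (a \notin Kc) then Some (t i a) else None.
pose ty i : Ty := (ltype R (tp s) (Bl i) q (side i true), ltype R (tp s) (Bl i) q (side i false)).
have [|tau [g g_inj gtau]] :=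
    pigeonhole_count (fun x : 'I_(2 * #|Ty|) => ty (nth 0 idx2 x)) (ty 0) (t := 2).
  by rewrite card_ord.
have memg x : nth 0 idx2 (g x) \in idx2 by rewrite mem_nth // (ltn_trans (ltn_ord _)).
have [i [j [i2 j2 ij tyE]]] : exists i j, [/\ i \in idx2, j \in idx2, i < j & ty i = ty j].
  have tyg : ty (nth 0 idx2 (g ord0)) = ty (nth 0 idx2 (g ord_max)) by rewrite !gtau.
  case: (ltngtP (nth 0 idx2 (g ord0)) (nth 0 idx2 (g ord_max))) => [lt|lt|/eqP].
  - by exists (nth 0 idx2 (g ord0)), (nth 0 idx2 (g ord_max)).
  - by exists (nth 0 idx2 (g ord_max)), (nth 0 idx2 (g ord0)).
  rewrite nth_uniq ?(ltn_trans (ltn_ord _)) ?filter_uniq //.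
  by move=> /eqP/val_inj/g_inj.
have mem1 := mem_subseq sub1; have mem2 := mem_subseq sub2.
exists i, j; split=> //; [exact/mem1/mem2|exact/mem1/mem2|].
have lay : layered R (tp s) (Bl i) (Bl j).
  apply: ball_layered => // x xi xj.
  by move: ij; rewrite (dis i j x) ?ltnn //; exact: mem2.
(* Kernel positions are common to both tuples and lie outside the two balls, so they are played
   identically. *)
pose p a := if a \in Kc then None else Some (P a).
have nball a l : l \in idx2 -> a \in Kc -> t i0 a \notin Bl l R.
  rewrite mem_filter => /andP[/hasPn H _] aK; rewrite /Bl subnn drop0; apply: H.
  by apply: map_f; rewrite mem_enum.
have toi0 a l : l \in idx2 -> a \in Kc -> t l a = t i0 a.
  by move=> l2 aK; apply: const => //; exact/mem1/mem2.
have B0 a l : a \notin Kc -> t l a \in Bl l 0.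
  move=> aK; rewrite /Bl subn0 -sF drop_size inE /=; apply/existsP.
  by exists (exist _ a aK : W).
have locT l l' b : local p b (fun a => if P a == b then t l a else t l' a) = side l b.
  apply: funext => a; rewrite /local /side /p.
  by case: (a \in Kc) (P a) b => [] [] [].
have locT1 l l' : local p true (fun a => if P a then t l a else t l' a) = side l true.
  by rewrite -(locT l l'); congr local; apply: funext => a; case: (P a).
have locF1 l l' : local p false (fun a => if P a then t l a else t l' a) = side l' false.
  by rewrite -(locT l' l); congr local; apply: funext => a; case: (P a).
case: tyE => tyT tyF.
(* Petals are centres, hence at level 0, and [R = 2 ^ q] is exactly the gap that [q] rounds
   require. *)
apply: (swapped_sat (k := q) (p := p) (lo := 0) (hi := R) (leqnn _) lay).
split; rewrite ?locT1 ?locF1 ?add0n ?leqnn //.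
- move=> a; rewrite /p; case: ifP => // /negbT aK [->]; by split; exact: B0.
- move=> a; rewrite /p; case: ifP => // /negbT aK [->]; by split; exact: B0.
- move=> a; rewrite /p; case: ifP => // aK _.
  by rewrite (toi0 a i) // (toi0 a j) // if_same; split=> //; exact: nball.
Qed.

(** * Sunflowers and the conclusion *)

Lemma stable_of_no_config (C : gclass) h :
  (forall G, C G -> ~ half_graph h G) -> no_config C -> stable C.
Proof.
move=> noh noc [k [l [phi H]]]; pose m := k + l.
(* Without variables all environments coincide, so not even two tuples can be ordered. *)
case: (posnP m) => [m0|mpos].
  have [G [_ [u [v uv]]]] := H 2.
  have E : join_env (u ord0) (v ord_max) = join_env (u ord_max) (v ord0).
    by apply: funext => -[a alt]; exfalso; rewrite -/m m0 in alt.
  by have := (uv ord0 ord_max).2 isT; rewrite E => /(uv ord_max ord0).1.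
pose P (a : 'I_m) := if split a is inl _ then true else false.
(* The kernel is known only once the tuples are, so the bound is made uniform over all candidate
   kernels. *)
have [M MP] := finite_bound (P := fun (Kc : {set 'I_m}) M => forall G, C G -> gV G ->
    forall (t : nat -> 'I_m -> gV G) (idx : seq nat), sorted ltn idx -> M <= size idx ->
    (forall i j a, i \in idx -> j \in idx -> a \in Kc -> t i a = t j a) ->
    (forall i j a b, i \in idx -> j \in idx -> a \notin Kc -> b \notin Kc -> t i a = t j b -> i = j) ->
    exists i j, [/\ i \in idx, j \in idx, i < j &
      sat phi (fun a => if P a then t i a else t j a) <-> sat phi (fun a => if P a then t j a else t i a)])
    (fun Kc M M' MM' HM G CG x0 t idx si Mi => HM G CG x0 t idx si (leq_trans MM' Mi))
    (fun Kc => swap_bound phi P Kc noh noc).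
have [N NP] := ramsey 2 {ffun 'I_m * 'I_m -> bool} (M + 3).
have [G [CG [u [v uv]]]] := H N.+1.
pose t i := join_env (u (inord i)) (v (inord i)).
pose x0 := t 0 (Ordinal mpos).
pose col (r : seq nat) : {ffun 'I_m * 'I_m -> bool} :=
  [ffun ab => t (nth 0 r 0) ab.1 == t (nth 0 r 1) ab.2].
have [||idx [g [sub sz Hg]]] := NP col (iota 0 N); rewrite ?size_iota ?iota_ltn_sorted //.
have sidx : sorted ltn idx := subseq_sorted ltn_trans sub (iota_ltn_sorted _ _).
have c i j a b : i \in idx -> j \in idx -> i < j -> (t i a == t j b) = g (a, b).
  move=> ii jj ij; have := Hg [:: i; j]; rewrite /= ij => /(_ isT) H'.
  have /H' : {subset [:: i; j] <= idx} by move=> x; rewrite !inE => /orP[]/eqP->.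
  by move=> /(_ erefl) /ffunP/(_ (a, b)); rewrite ffunE.
pose e q := nth 0 idx q.
have e_in q : q < 3 -> e q \in idx by move=> q3; rewrite mem_nth // sz; lia.
have e_lt q q' : q < q' -> q' < 3 -> e q < e q'.
  by move=> qq q3; apply: (sorted_ltn_nth ltn_trans) => //; rewrite inE sz; lia.
(* If position [a] of one tuple equals position [b] of two later ones, these two agree at [b], so
   [b] is in the kernel. This comparison accounts for the three extra indices. *)
have gdiag a b : g (a, b) -> g (b, b).
  move=> gab; have := c (e 1) (e 2) b b (e_in 1 isT) (e_in 2 isT) (e_lt 1 2 isT isT) => <-.
  have := c (e 0) (e 1) a b (e_in 0 isT) (e_in 1 isT) (e_lt 0 1 isT isT); rewrite gab => /eqP <-.
  by rewrite (c (e 0) (e 2) a b (e_in 0 isT) (e_in 2 isT) (e_lt 0 2 isT isT)).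
pose Kc := [set a | g (a, a)].
have [|||i [j [ii jj ij sE]]] := MP Kc G CG x0 t idx sidx.
- by rewrite sz leq_addr.
- move=> i j a ii jj; rewrite inE => ga; case: (ltngtP i j) => [ij|ji|->//].
    by apply/eqP; rewrite (c i j).
  by apply/esym/eqP; rewrite (c j i).
- move=> i j a b ii jj; rewrite !inE => na nb E; case: (ltngtP i j) => // [ij|ji].
    have := c i j a b ii jj ij; rewrite E eqxx => /esym/gdiag; by rewrite (negbTE nb).
  have := c j i b a jj ii ji; rewrite E eqxx => /esym/gdiag; by rewrite (negbTE na).
have mixE i' j' : (fun a => if P a then t i' a else t j' a) = join_env (u (inord i')) (v (inord j')).
  by apply: funext => a; rewrite /P /t /join_env; case: (split a).
have lt x : x \in idx -> x < N.+1.
  by move=> /(mem_subseq sub); rewrite mem_iota ltnS => /andP[_ /ltnW].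
rewrite !mixE in sE.
have := (uv (inord i) (inord j)).2; rewrite !inordK ?lt // => /(_ (ltnW ij)) /sE.
by move=> /(uv (inord j) (inord i)).1; rewrite !inordK ?lt // leqNgt ij.
Qed.

Lemma NIP_of_stable (C : gclass) : stable C -> NIP C.
Proof.
move=> st [k [l [phi H]]]; apply: st; exists k, l, phi => n.
have [G [CG [u [v uv]]]] := H n; exists G; split=> //.
exists u, (fun j => v [set i : 'I_n | i <= j]) => i j.
by rewrite uv inE.
Qed.

Theorem mainTheorem2 :
  (forall C : gclass, hereditary C ->
     (forall p : nat, 0 < p -> exists (D : gclass) (f : nat -> nat),
         hereditary D /\ NIP D /\ nondecreasing f /\ subpoly f /\ has_decomp C D f p) ->
     (exists (S : gclass) (g : nat -> nat),
         hereditary S /\ stable S /\ nondecreasing g /\ subpoly g /\ has_decomp C S g 2) ->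
     stable C)
  /\ decomposition_horizon Pi_stable.
Proof.
have main : forall C : gclass, hereditary C ->
     (forall p : nat, 0 < p -> exists (D : gclass) (f : nat -> nat),
         hereditary D /\ NIP D /\ nondecreasing f /\ subpoly f /\ has_decomp C D f p) ->
     (exists (S : gclass) (g : nat -> nat),
         hereditary S /\ stable S /\ nondecreasing g /\ subpoly g /\ has_decomp C S g 2) ->
     stable C.
  move=> C hC decN [S [g [hS [stS [gm [gs dec2]]]]]].
  have [h noh] := no_half_graph_of_stable_decomp hC hS stS gm gs dec2.
  exact: (stable_of_no_config noh (no_config_of_NIP_decomp hC decN)).
split=> // C; split=> [[hC dec]|[hC stC]].
  split=> //; apply: main => //.
    move=> p /dec[f [D [[hD stD] [fm [fs fD]]]]].
    by exists D, f; split=> //; split; first exact: NIP_of_stable.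
  have [f [D [[hD stD] [fm [fs fD]]]]] := dec 2 isT.
  by exists D, f.
(* Conversely, one part and the class itself form a decomposition for every parameter. *)
split=> // p p0; exists (fun=> 1), C; split=> //; split=> //; split.
  by move=> a a0; exists 1 => n n1; rewrite exp1n.
move=> G CG; exists 1; split=> //; exists (fun=> ord0) => s.
exact: hC.2.
Qed.
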